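(* Let $\mathbb S_0,\ldots,\mathbb S_{q-2}$ be $q-1$ disjoint exterior splashes on $\ell_\infty$ with common carriers $E_1,E_2$. Then the two covers of each exterior splash $\mathbb S_j$ can be labelled $\mathbb C_j$, $\mathbb T_j$ in such a way that, in $\mathrm{PG}(5,q^3)$, the covers $\mathbb C_0,\ldots,\mathbb C_{q-2}$ have common transversal lines $g_{\mathbb C},g_{\mathbb C}^q,g_{\mathbb C}^{q^2}$, and the covers $\mathbb T_0,\ldots,\mathbb T_{q-2}$ have common transversal lines $g_{\mathbb T},g_{\mathbb T}^q,g_{\mathbb T}^{q^2}$.
   Context: Let $q$ be a prime power, $\tau$ a primitive element of $\mathbb F_{q^3}$, and for $\alpha=a_0+a_1\tau+a_2\tau^2$ ($a_i\in\mathbb F_q$) write $[\alpha]=(a_0,a_1,a_2)$. Bruck-Bose correspondence at infinity: let $\ell_\infty$ be the line $z=0$ of $\mathrm{PG}(2,q^3)$. A point $L=(\alpha,\beta,0)$ of $\ell_\infty$ corresponds to the plane $[L]=\{([\alpha x],[\beta x]): x\in\mathbb F_{q^3}\setminus\{0\}\}$ of $\mathrm{PG}(5,q)$. The planes $[L]$ form a regular 2-spread $\mathcal S$ of $\mathrm{PG}(5,q)$. An order-$q$-subplane $\pi$ of $\mathrm{PG}(2,q^3)$ is an image of $\mathrm{PG}(2,q)$ under $\mathrm{PGL}(3,q^3)$. If $\pi$ is exterior to $\ell_\infty$ (no point of $\pi$ on $\ell_\infty$), its exterior splash is the set of $q^2+q+1$ points of $\ell_\infty$ lying on extended lines of $\pi$;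 the same term and symbol are used for the corresponding set of planes of $\mathcal S$. Carriers: let $I$ be the subgroup of $\mathrm{PGL}(3,q^3)$ fixing $\pi$ and $\ell_\infty$. It fixes exactly three lines $\ell_\infty,m,n$, which are conjugate with respect to $\pi$ (i.e. images of each other under the order-3 collineation group of $\mathrm{PG}(2,q^3)$ fixing $\pi$ pointwise). The carriers of the exterior splash of $\pi$ are the two points $\ell_\infty\cap m$ and $\ell_\infty\cap n$ of $\ell_\infty$. Given two points $E_1,E_2$ of $\ell_\infty$, there are $q-1$ mutually disjoint exterior splashes on $\ell_\infty$ with carriers $E_1,E_2$. Covers: for an exterior splash $\mathbb S$ (as a set of planes), by a result of Bruck there are two further sets (switching sets) of $q^2+q+1$ planes of $\mathrm{PG}(5,q)$, called the covers of $\mathbb S$. Planes in the same set are disjoint, the planes of $\mathbb S$ and of each cover have the same union as point sets, and planes from different sets (among $\mathbb S$ and its two covers) meet in exactly one point. Transversals: a transversal line of a set of planes of $\mathrm{PG}(5,q)$ is a line of $\mathrm{PG}(5,q^3)$ meeting the extension of every plane of the set. Each cover of an exterior splash has exactly three transversal lines, forming a conjugate triple $g,g^q,g^{q^2}$ under the Frobenius map $X\mapsto X^q$ on coordinates, disjoint from $\mathrm{PG}(5,q)$. *)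

(* Defs.v *)
From HB Require Import structures.
From mathcomp Require Import all_boot all_order all_algebra all_field.
From mathcomp Require Import finmap.

Set Implicit Arguments.
Unset Strict Implicit.
Unset Printing Implicit Defensive.

Import GRing.Theory.
Local Open Scope ring_scope.

(* PG(n-1, K) is the lattice of subspaces of 'rV[K]_n: points, lines and planes
   are the subspaces U with \dim U = 1, 2 and 3, projective disjointness is
   (U :&: V = 0)%VS, and incidence is (U <= V)%VS. *)

Section Projective.

Variables (K : fieldType) (n : nat).

(* M : 'M[K]_n represents an element of PGL(n, K), acting on row vectors from
   the right. *)
Definition homography (M : 'M[K]_n) (U : {vspace 'rV[K]_n}) :
    {vspace 'rV[K]_n} :=
  (linfun (mulmxr M) @: U)%VS.

End Projective.

(* The subspace spanned by the coordinatewise image of U under f; for f a field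
   morphism this does not depend on the basis of U. *)
Definition map_vspace (K K' : fieldType) (f : K -> K') (n : nat)
    (U : {vspace 'rV[K]_n}) : {vspace 'rV[K']_n} :=
  <<[seq map_mx f v | v <- vbasis U]>>%VS.

Section BruckBose.

Variables (F : finFieldType) (L : fieldExtType F).

Local Notation q := #|F|.
Local Notation PG2 := {vspace 'rV[L]_3}.
Local Notation PG5 := {vspace 'rV[F]_6}.

Definition primitive_element (tau : L) : Prop :=
  forall x : L, x != 0 -> exists n : nat, x = tau ^+ n.

Definition coordinates (tau a : L) : 'rV[F]_3 :=
  \row_(i < 3) coord [tuple tau ^+ k | k < 3] i a.

Definition bb_plane (tau a b : L) : PG5 :=
  limg (linfun (fun x : L =>
    row_mx (coordinates tau (a * x)) (coordinates tau (b * x)) : 'rV[F]_6)).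

(* The plane [P] of a point P on z = 0; it does not depend on the choice of the
   vector representing P. *)
Definition bb_point (tau : L) (P : PG2) : PG5 :=
  bb_plane tau (vpick P 0 0) (vpick P 0 1).

Definition bb_planes (tau : L) (S : {fset PG2}) : {fset PG5} :=
  [fset bb_point tau P | P in S]%fset.

Definition line_infty : PG2 := lker (linfun (col (ord_max : 'I_3))).

Definition order_q_subplane (pi : {fset PG2}) : Prop :=
  exists2 M : 'M[L]_3, M \in unitmx &
    forall P : PG2, P \in pi <->
      exists2 U : {vspace 'rV[F]_3}, \dim U = 1%N &
        P = homography M (map_vspace (in_alg L) U).

Definition exterior (pi : {fset PG2}) : Prop :=
  forall P, P \in pi -> ~~ (P <= line_infty)%VS.

Definition extended_line (pi : {fset PG2}) (l : PG2) : Prop :=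
  exists P Q : PG2, [/\ P \in pi, Q \in pi, P != Q & l = (P + Q)%VS].

Definition splash_of (pi S : {fset PG2}) : Prop :=
  forall P : PG2, P \in S <->
    [/\ \dim P = 1%N, (P <= line_infty)%VS &
        exists2 l, extended_line pi l & (P <= l)%VS].

(* Membership in the subgroup I of PGL(3, q^3) fixing pi and the line at
   infinity. *)
Definition in_I (pi : {fset PG2}) (M : 'M[L]_3) : Prop :=
  [/\ M \in unitmx, [fset homography M P | P in pi]%fset = pi &
      homography M line_infty = line_infty].

Definition fixed_line (pi : {fset PG2}) (l : PG2) : Prop :=
  \dim l = 2%N /\ forall M, in_I pi M -> homography M l = l.

Definition carriers_of (pi : {fset PG2}) (E1 E2 : PG2) : Prop :=
  exists m n : PG2,
    [/\ uniq [:: line_infty; m; n],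
        (forall l, fixed_line pi l <-> l \in [:: line_infty; m; n]),
        E1 = (line_infty :&: m)%VS & E2 = (line_infty :&: n)%VS].

Definition exterior_splash (S : {fset PG2}) (E1 E2 : PG2) : Prop :=
  exists pi : {fset PG2},
    [/\ order_q_subplane pi, exterior pi, splash_of pi S &
        carriers_of pi E1 E2].

Definition covered (A : {fset PG5}) (P : PG5) : Prop :=
  exists2 W, W \in A & (P <= W)%VS.

Definition switching_set (A B : {fset PG5}) : Prop :=
  [/\ #|` B|%fset = (q ^ 2 + q + 1)%N,
      (forall W, W \in B -> \dim W = 3%N),
      (forall W W', W \in B -> W' \in B -> W != W' -> (W :&: W' = 0)%VS),
      (forall P : PG5, \dim P = 1%N -> covered A P <-> covered B P) &
      (forall W W', W \in A -> W' \in B -> \dim (W :&: W')%VS = 1%N)].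

(* C and T are the two covers of A: they are its only switching sets, and each
   is a switching set of the other. *)
Definition covers_of (A C T : {fset PG5}) : Prop :=
  (forall B, switching_set A B <-> B = C \/ B = T) /\ switching_set C T.

Definition conjugate (g : {vspace 'rV[L]_6}) : {vspace 'rV[L]_6} :=
  map_vspace (fun x : L => x ^+ q) g.

Definition transversal (A : {fset PG5}) (g : {vspace 'rV[L]_6}) : Prop :=
  \dim g = 2%N /\
  forall W, W \in A -> (g :&: map_vspace (in_alg L) W != 0)%VS.

(* The transversal lines of A are exactly the three lines g, g^q, g^(q^2). *)
Definition transversals_of (A : {fset PG5}) (g : {vspace 'rV[L]_6}) : Prop :=
  uniq [:: g; conjugate g; conjugate (conjugate g)] /\
  forall h, transversal A h <->
    h \in [:: g; conjugate g; conjugate (conjugate g)].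

End BruckBose.

(* Main.v *)
From HB Require Import structures.
Require Import Defs.
From mathcomp Require Import all_boot all_order all_algebra all_field.
From mathcomp Require Import finmap.
From mathcomp Require Import ring zify.

Set Implicit Arguments.
Unset Strict Implicit.
Unset Printing Implicit Defensive.

Import GRing.Theory.
Local Open Scope ring_scope.

(** Write sigma for the map x |-> x^q of L, and N(x) = x^n with n = q^2 + q + 1
    for the norm from L to F.

    The group I consists, up to scalars, of matrices over F in the frame of the
    subplane pi, so it fixes with the line at infinity u = 0 also its two
    conjugates, and these three lines are a triangle.  In the coordinates
    (u, u^sigma, u^(sigma^2)) of this triangle pi is the set of the points
    (t, t^q, t^(q^2)), and a short computation with Hilbert 90 shows that the
    splash is { (0, y, z) : N(y) = N(-z) }, the carriers being (0, 1, 0) and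
    (0, 0, 1) ([splash_norm], [norm_splash]).  Splashes with the same carriers
    therefore differ only in the ratio N(y) / N(z): with fixed coordinates y, z
    on the line at infinity each of them is N(y) = N(k z) for some nonzero k
    ([splash_coordinates_change]).

    Through the Bruck-Bose correspondence F^6 becomes L^2, with F-linear
    coordinates y, z, and the splash becomes the set of the planes y = k z where
    N(k) is a given constant c.  For e modulo 3 let the class e be the set of
    the planes y = k z^(q^e) with N(k) = c.  The classes 1 and 2 are the two
    covers of the class 0.

    - Each class covers exactly the points with N(y) = c N(z), and planes of
      different classes meet in one point by Hilbert 90
      ([switching_norm_class]).
    - Conversely, a plane of a switching set has no point with z = 0, so it is a
      graph y = A_0 z + A_1 z^q + A_2 z^(q^2).  It meets every plane y = k z of
      the splash, so a 3 x 3 determinant vanishes for every k of norm c.  This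
      determinant is a combination of the seven functions 1, k, k^q, k^(q^2),
      k^(q+1), k^(q^2+q), k^(q^2+1) of k.  They are linearly independent on
      the n elements k of norm c, because the exponents are distinct and
      smaller than n ([normic_poly_eq0]).  The coefficients give A_0 = 0 and
      A_1 A_2 = 0, so the plane is in class 1 or in class 2
      ([switching_norm_class_unique]).

    Over L the conjugates Y_j of y and Z_j of z are six independent coordinates,
    and the plane y = k z^(q^e) extends to the space Y_j = k^(q^j) Z_(j+e) for
    all j.  The line on which only Y_i and Z_(i+e) are nonzero meets all these
    spaces, and it does not depend on k, hence not on the constant c: this is
    why the covers of all the splashes share it.  The three lines i = 0, 1, 2
    are conjugate.  There are no other transversals, since the independence of
    the seven functions, applied to the 2 x 2 minors that express that a line
    meets all the spaces, makes all Pluecker coordinates of the line vanish but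
    those of one pair Y_i, Z_(i+e) ([transversal_coordinate_line]). *)

(** * The conjugations of a cubic extension *)

(** The exponent lives in 'I_3 for its addition modulo 3: when L is cubic over
    F, these three maps are the Galois group of L over F. *)
Definition frob (F : finFieldType) (L : fieldExtType F) (j : 'I_3) (x : L) : L :=
  x ^+ (#|F| ^ j).

Section FrobeniusMorphism.
Variables (F : finFieldType) (L : fieldExtType F) (j : 'I_3).

Lemma frob_is_nmod : nmod_morphism (@frob F L j).
Proof.
split=> [|x y]; first by rewrite /frob expr0n expn_eq0 -leqn0 leqNgt (cardD1 0).
have [p p_pr charF] := finPcharP F.
have charL : p \in [pchar L] by rewrite pchar_lalg.
rewrite /frob exprDn_pchar // pnatX (eq_pnat _ (pcharf_eq charL)).
by rewrite (card_pprimeChar charF) pnatX pnat_id.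
Qed.

Lemma frob_is_monoid : monoid_morphism (@frob F L j).
Proof. by split=> [|x y]; rewrite /frob ?expr1n ?exprMn. Qed.

HB.instance Definition _ :=
  GRing.isNmodMorphism.Build L L (@frob F L j) frob_is_nmod.
HB.instance Definition _ :=
  GRing.isMonoidMorphism.Build L L (@frob F L j) frob_is_monoid.

Lemma frob_in_alg a : frob j (in_alg L a) = in_alg L a.
Proof.
rewrite /frob -rmorphXn; congr (in_alg L _).
by elim: (j : nat) => [|m IHm]; rewrite ?expr1 // expnS exprM expf_card.
Qed.

End FrobeniusMorphism.

Lemma ord3P (j : 'I_3) : [\/ j = 0, j = 1 | j = -1].
Proof.
case: j => -[|[|[|//]]] jP; [exact: Or31 (val_inj _)|exact: Or32 (val_inj _)|].
exact: Or33 (val_inj _).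
Qed.

Lemma ord3_11 : 1 + 1 = -1 :> 'I_3. Proof. exact: val_inj. Qed.

Lemma ord3_N11 : -1 - 1 = 1 :> 'I_3. Proof. exact: val_inj. Qed.

(** Sums over 'I_3 are expanded from any starting index, which keeps cyclic
    symmetries visible. *)
Lemma sum_ord3 (V : zmodType) (j : 'I_3) (G : 'I_3 -> V) :
  \sum_i G i = G j + G (j + 1) + G (j - 1).
Proof.
rewrite (reindex_inj (addrI j)) /= !big_ord_recl big_ord0 !addr0 addrA.
have eqG i k : i = k -> G i = G k by move=> ->.
by congr (_ + _ + _); apply: eqG; apply: (congr1 (+%R j)); apply: val_inj.
Qed.

(** The multiplicative group of a finite field is cyclic. *)
Lemma finField_prim_root (K : finFieldType) :
  exists r : K, #|K|.-1.-primitive_root r.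
Proof.
have K_gt1 := finNzRing_gt1 K.
have /hasP [r _ prim_r] :
    has #|K|.-1.-primitive_root [seq x <- enum K | x != 0]; last by exists r.
apply: cyclic.has_prim_root.
- by rewrite -subn1 subn_gt0.
- apply/allP => x; rewrite mem_filter => /andP [x0 _].
  rewrite unity_rootE; apply/eqP; apply: (mulfI x0).
  by rewrite mulr1 -exprS prednK ?expf_card // ltnW.
- by rewrite filter_uniq ?enum_uniq.
rewrite size_filter cardE -(count_predC (pred1 0)).
by rewrite count_uniq_mem ?enum_uniq // mem_enum inE add1n.
Qed.

(** * Subspaces and homographies *)

Lemma dim1_line (K : fieldType) (V : vectType K) (U : {vspace V}) :
  \dim U = 1%N -> vpick U != 0 /\ U = <[vpick U]>%VS.
Proof.
move=> dimU; have U0 : vpick U != 0 by rewrite vpick0 -dimv_eq0 dimU.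
split=> //; apply/eqP; rewrite eq_sym eqEdim dim_vline U0 dimU /= leqnn andbT.
by rewrite -memvE memv_pick.
Qed.

Lemma mem_map_vspace (K K' : fieldType) (f : {rmorphism K -> K'}) m
    (U : {vspace 'rV[K]_m}) v : v \in U -> map_mx f v \in map_vspace f U.
Proof.
move=> /coord_vbasis ->; rewrite map_mx_sum memv_suml // => i _.
by rewrite map_mxZ memvZ // memv_span // map_f // mem_nth ?size_tuple.
Qed.

Lemma map_vspace_sub (K K' : fieldType) (f : K -> K') m
    (U : {vspace 'rV[K]_m}) (V : {vspace 'rV[K']_m}) :
  (forall v, v \in U -> map_mx f v \in V) -> (map_vspace f U <= V)%VS.
Proof.
by move=> UV; apply/span_subvP => _ /mapP [v /vbasis_mem vU ->]; apply: UV.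
Qed.

Lemma dim2_basis (K : fieldType) (V : vectType K) (U : {vspace V}) :
  \dim U = 2%N -> exists u u', free [:: u; u'] /\ U = <<[:: u; u']>>%VS.
Proof.
move=> dimU; have /andP [/eqP spanU freeU] := vbasisP U.
have : size (vbasis U) = 2%N by rewrite size_tuple.
move: spanU freeU.
by case: (tval (vbasis U)) => [|u [|u' []]] // <- freeU _; exists u, u'.
Qed.

Lemma map_vspace_line (K K' : fieldType) (f : {rmorphism K -> K'}) m
  (v : 'rV[K]_m) : map_vspace f <[v]>%VS = <[map_mx f v]>%VS.
Proof.
apply/eqP; rewrite eqEsubv; apply/andP; split; last first.
  by rewrite -memvE mem_map_vspace ?memv_line.
apply: map_vspace_sub => _ /vlineP [a ->].
by rewrite map_mxZ memvZ ?memv_line.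
Qed.

Lemma homography_line (K : fieldType) m (M : 'M[K]_m) (v : 'rV[K]_m) :
  homography M <[v]>%VS = <[v *m M]>%VS.
Proof. by rewrite /homography limg_line lfunE. Qed.

Lemma line_eq (K : fieldType) (V : vectType K) (v w : V) :
  v != 0 -> <[v]>%VS = <[w]>%VS -> exists2 a, a != 0 & v = a *: w.
Proof.
move=> v0 vw; have /vlineP [a va] : v \in <[w]>%VS by rewrite -vw memv_line.
by exists a => //; apply: contraNneq v0 => a0; rewrite va a0 scale0r.
Qed.

Lemma homography_stable (K : fieldType) m (N : 'M[K]_m) (V : {vspace 'rV[K]_m}) :
  N \in unitmx -> (forall x, x \in V -> x *m N \in V) -> homography N V = V.
Proof.
move=> Nunit VN; apply/eqP; rewrite eqEdim; apply/andP; split.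
  by apply/subvP => _ /memv_imgP [x xV ->]; rewrite lfunE /= VN.
rewrite limg_dim_eq //; apply/eqP; rewrite -subv0; apply/subvP => x.
rewrite memv_cap memv_ker lfunE /= memv0 => /andP [_ /eqP xN].
by rewrite -(mulmxK Nunit x) xN mul0mx.
Qed.

(** The image of the basis gives N = D R with R over K and D diagonal, and the
    image of the point (1, ..., 1) forces D to be a scalar multiple of a matrix
    over K. *)
Lemma base_homography (K : fieldType) (E : fieldExtType K) m (N : 'M[E]_m) :
    N \in unitmx ->
    (forall u : 'rV[K]_m, u != 0 -> exists s (u' : 'rV[K]_m),
       map_mx (in_alg E) u *m N = s *: map_mx (in_alg E) u') ->
  exists s (N0 : 'M[K]_m), N = s *: map_mx (in_alg E) N0.
Proof.
case: m N => [|m] N; first by exists 0, 0; apply/matrixP => -[].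
move=> Nunit Nbase.
have row_ex i : exists s, exists u' : 'rV[K]_m.+1,
    row i N = s *: map_mx (in_alg E) u'.
  have [|s [u' E1]] := Nbase (delta_mx 0 i).
    by apply/eqP => /rowP/(_ i)/eqP; rewrite !mxE !eqxx oner_eq0.
  by exists s, u'; rewrite -E1 map_delta_mx -rowE.
have [s sP] := fin_all_exists row_ex; have [u' uP] := fin_all_exists sP.
pose R := \matrix_i u' i; pose d := \row_i s i.
have NE : N = diag_mx d *m map_mx (in_alg E) R.
  apply/matrixP => i j; rewrite mul_diag_mx !mxE.
  by have /rowP/(_ j) := uP i; rewrite !mxE.
have Runit : R \in unitmx.
  rewrite -(map_unitmx (in_alg E)).
  by move: Nunit; rewrite NE unitmx_mul => /andP [].
have [|t [v vP]] := Nbase (const_mx 1).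
  by apply/eqP => /rowP/(_ 0)/eqP; rewrite !mxE oner_eq0.
have dE : d = t *: map_mx (in_alg E) (v *m invmx R).
  rewrite map_mxM map_invmx scalemxAl -vP NE mulmxA mulmxK ?map_unitmx //.
  apply/rowP => i; rewrite mul_mx_diag !mxE rmorph1 mul1r //.
exists t, (diag_mx (v *m invmx R) *m R).
by rewrite map_mxM map_diag_mx scalemxAl -linearZ -dE.
Qed.

(** The determinant of a system in z, z1, z2, whose second and third equations
    list their terms in the cyclic order in which conjugation produces them. *)
Lemma det3_eq0 (K : fieldType) (a a1 a2 b b1 b2 d d1 d2 z z1 z2 : K) : z != 0 ->
    a * z + b * z1 + d * z2 = 0 -> a1 * z1 + b1 * z2 + d1 * z = 0 ->
    a2 * z2 + b2 * z + d2 * z1 = 0 ->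
  a * a1 * a2 + b * b1 * b2 + d * d1 * d2
    - a * b1 * d2 - a1 * d * b2 - a2 * b * d1 = 0.
Proof.
move=> z0 e0 e1 e2; apply: (mulIf z0); rewrite mul0r.
rewrite -[RHS](_ : (a1 * a2 - b1 * d2) * (a * z + b * z1 + d * z2)
  - (b * a2 - d * d2) * (a1 * z1 + b1 * z2 + d1 * z)
  + (b * b1 - d * a1) * (a2 * z2 + b2 * z + d2 * z1) = 0); first ring.
by rewrite e0 e1 e2 !mulr0 subrr addr0.
Qed.

(** * Linear forms with coefficients in the extension *)

(** The conjugates of the linear form c; the index 0 gives c itself. *)
Definition cform (F : finFieldType) (L : fieldExtType F) m (c : 'cV[L]_m)
    (j : 'I_3) (w : 'rV[L]_m) : L := (w *m map_mx (frob j) c) 0 0.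

(** On base vectors the conjugates of a form carry the same information, so
    there one F-linear map with values in L is enough. *)
Definition val_form (F : finFieldType) (L : fieldExtType F) m (c : 'cV[L]_m)
    (v : 'rV[F]_m) : L := cform c 0 (map_mx (in_alg L) v).

Section Forms.
Variables (F : finFieldType) (L : fieldExtType F) (m : nat) (c : 'cV[L]_m).

Lemma cform_is_linear j : linear_for *%R (cform c j).
Proof. by move=> a w w'; rewrite /cform mulmxDl -scalemxAl !mxE. Qed.

HB.instance Definition _ j :=
  GRing.isLinear.Build L 'rV[L]_m L *%R (cform c j) (cform_is_linear j).

Lemma val_form_is_linear : linear (val_form c).
Proof.
move=> a v v'; rewrite /val_form map_mxD map_mxZ linearD linearZ /=.
by rewrite mulr_algl.
Qed.

HB.instance Definition _ :=
  GRing.isLinear.Build F 'rV[F]_m L *:%R (val_form c) val_form_is_linear.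

End Forms.

Section CubicExtension.
Variables (F : finFieldType) (L : fieldExtType F).
Hypothesis dimL : \dim {:L} = 3%N.

Local Notation q := #|F|.
Local Notation n := (q ^ 2 + q + 1)%N.

(** * Norm, trace and descent *)

Lemma q_gt1 : (1 < q)%N.
Proof. exact: finNzRing_gt1. Qed.

Lemma card_L : #|finvect_type L| = (q ^ 3)%N.
Proof. by rewrite -dimL -(card_vspace {:finvect_type L}%VS) card_vspacef. Qed.

Lemma expr_q3 (x : L) : x ^+ (q ^ 3) = x.
Proof. by rewrite -card_L (expf_card (x : finvect_type L)). Qed.

Lemma frobD i j (x : L) : frob (i + j) x = frob i (frob j x).
Proof.
rewrite /frob -exprM -expnD addnC /= [in RHS](divn_eq (i + j) 3).
elim: (_ %/ 3)%N => // m IHm.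
by rewrite mulSn -addnA expnD exprM expr_q3.
Qed.

Lemma frob0 (x : L) : frob 0 x = x.
Proof. by rewrite /frob expn0 expr1. Qed.

Lemma map_frobD i j m1 m2 (B : 'M[L]_(m1, m2)) :
  map_mx (frob (i + j)) B = map_mx (frob i) (map_mx (frob j) B).
Proof. by apply/matrixP => a b; rewrite !mxE frobD. Qed.

Lemma map_frob0 m1 m2 (B : 'M[L]_(m1, m2)) : map_mx (frob 0) B = B.
Proof. by apply/matrixP => a b; rewrite mxE frob0. Qed.

Lemma map_frobNK j m1 m2 (B : 'M[L]_(m1, m2)) :
  map_mx (frob j) (map_mx (frob (- j)) B) = B.
Proof. by rewrite -map_frobD subrr map_frob0. Qed.

Lemma frobK j : cancel (@frob F L j) (@frob F L (- j)).
Proof. by move=> x; rewrite -frobD addNr frob0. Qed.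

(** The elements of F already are the q roots of X^q - X. *)
Lemma frob_fixed (x : L) : frob 1 x = x -> exists a : F, x = in_alg L a.
Proof.
rewrite /frob expn1 => xq.
have: root (map_poly (in_alg L) ('X^q - 'X)) x.
  by rewrite rmorphB /= map_polyXn map_polyX rootE !(hornerE, hornerXn) xq subrr.
have -> : map_poly (in_alg L) ('X^q - 'X) =
    \prod_(z <- [seq in_alg L b | b : F]) ('X - z%:P).
  rewrite finField_genPoly rmorph_prod big_image /=.
  by apply: eq_bigr => b _; rewrite rmorphB /= map_polyX map_polyC.
by rewrite root_prod_XsubC => /mapP[a]; exists a.
Qed.

(** The n-th power is the norm from L to F. *)
Lemma expr_n (x : L) : x ^+ n = x * frob 1 x * frob (-1) x.
Proof. by rewrite /frob /= expn1 addn1 exprS addnC exprD mulrA. Qed.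

Lemma frob_expr_n j (x : L) : frob j (x ^+ n) = x ^+ n.
Proof.
rewrite expr_n !rmorphM /= -!frobD.
case: (ord3P j) => ->; rewrite ?add0r ?frob0 //.
  by rewrite ord3_11 subrr frob0; ring.
by rewrite addNr frob0 ord3_N11; ring.
Qed.

(** The sum of the conjugates is fixed by frob 1, so it comes from F; the choice
    of a preimage gives a trace with values in F itself. *)
Definition trace (x : L) : F :=
  odflt 0 [pick a | in_alg L a == \sum_j frob j x].

Lemma traceE x : in_alg L (trace x) = \sum_j frob j x.
Proof.
rewrite /trace; case: pickP => [a /eqP //|noa].
have [|a ax] := @frob_fixed (\sum_j frob j x); last first.
  by have := noa a; rewrite ax eqxx.
rewrite rmorph_sum [RHS](reindex_inj (addrI 1)).
by apply: eq_bigr => j _; rewrite frobD.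
Qed.

Definition trace_mx m1 m2 (w : 'M[L]_(m1, m2)) : 'M[F]_(m1, m2) := map_mx trace w.

Lemma trace_mxE m1 m2 (w : 'M[L]_(m1, m2)) :
  map_mx (in_alg L) (trace_mx w) = \sum_j map_mx (frob j) w.
Proof.
apply/matrixP => i k; rewrite summxE !mxE traceE.
by apply: eq_bigr => j _; rewrite mxE.
Qed.

Variable tau : L.
Hypothesis tau_prim : primitive_element tau.

Lemma frob_tau_neq : tau != frob 1 tau.
Proof.
apply/eqP => /esym/frob_fixed [a ta].
have /dimvS : (fullv <= (1%VS : {vspace L}))%VS.
  apply/subvP => x _.
  have [->|/tau_prim [m ->]] := eqVneq x 0; first exact: mem0v.
  by rewrite ta -rmorphXn /= memvZ ?memv_line.
by rewrite dimv1 dimL.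
Qed.

Lemma frob_tau_eq i j : (frob i tau == frob j tau) = (i == j).
Proof.
apply/eqP/eqP => [|-> //] eq_ij.
suff: j - i = 0 by move/eqP; rewrite subr_eq0 => /eqP.
have: frob (j - i) tau = tau.
  by rewrite addrC frobD -eq_ij frobK.
case: (ord3P (j - i)) => -> //.
  by move/esym/eqP; rewrite (negPf frob_tau_neq).
move/(congr1 (frob 1)); rewrite -frobD subrr frob0.
by move/eqP; rewrite (negPf frob_tau_neq).
Qed.

(** Linear independence of the three automorphisms; the values at 1, tau and
    tau^2 suffice, by Lagrange interpolation at the conjugates of tau. *)
Lemma frob_independent (A : 'I_3 -> L) :
  (forall t, \sum_j A j * frob j t = 0) -> forall j, A j = 0.
Proof.
move=> Asum j.
pose x1 := frob (j + 1) tau; pose x2 := frob (j - 1) tau; pose x0 := frob j tau.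
have neq0 : (x0 - x1) * (x0 - x2) != 0.
  by rewrite mulf_neq0 // subr_eq0 frob_tau_eq -subr_eq0 ?opprD ?opprK addNKr.
have expand t : A j * frob j t + A (j + 1) * frob (j + 1) t
    + A (j - 1) * frob (j - 1) t = 0.
  by rewrite -(Asum t) (sum_ord3 j).
have := expand 1; have := expand tau; have := expand (tau ^+ 2).
rewrite !rmorphXn /= !rmorph1 !mulr1 -/x0 -/x1 -/x2 => e2 e1 e0.
apply/eqP; rewrite -(mulIr_eq0 _ (mulIf neq0)); apply/eqP.
have -> : A j * ((x0 - x1) * (x0 - x2)) =
  (A j * x0 ^+ 2 + A (j + 1) * x1 ^+ 2 + A (j - 1) * x2 ^+ 2)
  - (x1 + x2) * (A j * x0 + A (j + 1) * x1 + A (j - 1) * x2)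
  + x1 * x2 * (A j + A (j + 1) + A (j - 1)) by ring.
by rewrite e2 e1 e0 !mulr0 subrr addr0.
Qed.

(** Galois descent: w is an L-combination of the traces of w, tau w and tau^2 w,
    the coefficients being, up to a common factor, those of the polynomial
    (X - x1) (X - x2) that vanishes at the conjugates of tau other than tau. *)
Lemma trace_descent m (V : {vspace 'rV[L]_m}) (w : 'rV[L]_m) :
  (forall t, map_mx (in_alg L) (trace_mx (t *: w)) \in V) -> w \in V.
Proof.
move=> Vtr.
pose x1 := frob 1 tau; pose x2 := frob (-1) tau.
pose D := (tau - x1) * (tau - x2).
have D0 : D != 0.
  by rewrite mulf_neq0 // subr_eq0 -{1}[tau]frob0 frob_tau_eq.
suff: D *: w \in V by move/(memvZ D^-1); rewrite scalerA mulVf // scale1r.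
have -> : D *: w = map_mx (in_alg L) (trace_mx (tau ^+ 2 *: w))
    - (x1 + x2) *: map_mx (in_alg L) (trace_mx (tau *: w))
    + (x1 * x2) *: map_mx (in_alg L) (trace_mx (1 *: w)).
  rewrite !trace_mxE; apply/rowP => i; rewrite !mxE !summxE !(sum_ord3 0) !mxE.
  rewrite !add0r !rmorphM !rmorph1 /= !frob0 /D -/x1 -/x2; ring.
by rewrite rpredD ?rpredB ?memvZ ?Vtr.
Qed.

(** Forms that separate the base vectors have conjugates that separate all
    vectors: if the conjugates vanish at w then the forms vanish at every trace
    of a multiple of w. *)
Lemma moore_kernel m r (H : 'M[L]_(m, r)) :
    (forall v : 'rV[F]_m, map_mx (in_alg L) v *m H = 0 -> v = 0) ->
  forall w : 'rV[L]_m, (forall j, w *m map_mx (frob j) H = 0) -> w = 0.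
Proof.
move=> Hinj w wH; apply/eqP; rewrite -memv0; apply: trace_descent => t.
suff -> : trace_mx (t *: w) = 0 by rewrite map_mx0 mem0v.
apply: Hinj; rewrite trace_mxE mulmx_suml big1 // => j _.
by rewrite -[H](map_frobNK j) -map_mxM -scalemxAl wH scaler0 map_mx0.
Qed.

(** The solution is a Lagrange resolvent, which is nonzero for some b by
    independence of the automorphisms. *)
Lemma hilbert90 (k : L) : k ^+ n = 1 -> exists2 z, z != 0 & frob 1 z = k * z.
Proof.
rewrite expr_n; set k1 := frob 1 k; set k2 := frob (-1) k => kn.
have fk1 : frob 1 k1 = k2 by rewrite -frobD ord3_11.
have fk2 : frob 1 k2 = k by rewrite -frobD subrr frob0.
move: k1 k2 kn fk1 fk2 => k1 k2 kn fk1 fk2.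
pose z b := b + k1 * k2 * frob 1 b + k2 * frob (-1) b.
have zE b : frob 1 (z b) = k * z b.
  rewrite /z !rmorphD !rmorphM /= fk1 fk2 -!frobD subrr ord3_11 frob0.
  rewrite -[in LHS](mul1r (frob 1 b)) -kn; ring.
have [t zt0|z0] := pickP (fun t : finvect_type L => z t != 0).
  by exists (z t).
pose A (j : 'I_3) := if j == 0 then 1 else if j == 1 then k1 * k2 else k2.
suff: A 0 = 0 by move/eqP; rewrite /A eqxx oner_eq0.
apply: frob_independent => t; rewrite (sum_ord3 0) /A /= !add0r frob0 mul1r.
by apply/eqP/negbFE; apply: z0.
Qed.

Lemma n_prim_root : exists r : L, n.-primitive_root r.
Proof.
have [r prim_r] := finField_prim_root (finvect_type L).
have q1 := q_gt1.
have NE : #|finvect_type L|.-1 = (n * (q - 1))%N.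
  by rewrite card_L !expnS expn0; nia.
exists (r ^+ (q - 1) : L); have := dvdn_prim_root prim_r (m := n).
by rewrite NE mulKn ?addn1 // dvdn_mulr // => /(_ isT).
Qed.

(** There are n elements of given nonzero norm, namely the k0 r^i. *)
Lemma poly_vanish (p : {poly L}) (r k0 : L) :
  n.-primitive_root r -> k0 != 0 -> (size p <= n)%N ->
  (forall i, p.[k0 * r ^+ i] = 0) -> p = 0.
Proof.
move=> prim_r k0_neq0 szp pr0.
apply: (@roots_geq_poly_eq0 _ p [seq k0 * r ^+ i | i <- iota 0 n]).
- by apply/allP => _ /mapP [i _ ->]; apply/rootP.
- rewrite map_inj_in_uniq ?iota_uniq // => i j; rewrite !mem_iota /= !add0n.
  move=> ilt jlt /(mulfI k0_neq0)/eqP; rewrite (eq_prim_root_expr prim_r).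
  by rewrite !modn_small // => /eqP.
by rewrite size_map size_iota.
Qed.

Lemma frob_expr (z : L) e : (frob e z) ^+ n = z ^+ n.
Proof. by rewrite -rmorphXn /= frob_expr_n. Qed.

Lemma frob_eq_scalar e e' (x : L) : e != e' -> frob e x = frob e' x ->
  exists a, x = in_alg L a.
Proof.
move=> neq_e eq_x; apply: frob_fixed.
have: frob (e - e') x = x by rewrite addrC frobD eq_x -frobD addNr frob0.
case: (ord3P (e - e')) => [/eqP|->|->] //; first by rewrite subr_eq0 (negPf neq_e).
by move=> xN1; rewrite -{1}xN1 -frobD subrr frob0.
Qed.

(** The planes y = k z^(q^e) and y = k' z^(q^e') have a point in common. *)
Lemma twisted_hilbert90 e e' (k k' : L) : e != e' -> k != 0 -> k ^+ n = k' ^+ n ->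
  exists2 z : L, z != 0 & k * frob e z = k' * frob e' z.
Proof.
move=> neq_e k0 kn; have n_gt0 : (0 < n)%N by rewrite addn1.
have k'0 : k' != 0.
  by have := expf_neq0 n k0; rewrite kn expf_eq0 n_gt0.
have kk'n : (k' / k) ^+ n = 1 by rewrite expr_div_n -kn divff // expf_neq0.
have k'kn : (k / k') ^+ n = 1 by rewrite expr_div_n -kn divff // expf_neq0.
have [d1|d2] : e = 1 + e' \/ e' = 1 + e.
  case: (ord3P (e - e')) => /eqP.
  - by rewrite subr_eq0 (negPf neq_e).
  - by rewrite subr_eq => /eqP ->; left.
  by rewrite subr_eq => /eqP ->; right; rewrite addNKr.
- have [u u0 uE] := hilbert90 kk'n; exists (frob (- e') u).
    by rewrite fmorph_eq0.
  by rewrite d1 frobD -!(frobD e') subrr frob0 uE; field.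
have [u u0 uE] := hilbert90 k'kn; exists (frob (- e) u).
  by rewrite fmorph_eq0.
by rewrite d2 frobD -!(frobD e) subrr frob0 uE; field.
Qed.

(** Decides the comparisons of exponents; lia sees q * q as an atom, so it is
    given the bound 2 * q <= q * q. *)
Ltac nat_eqs := repeat match goal with |- context [(?a == ?b)%N] =>
  first [ rewrite (_ : (a == b)%N = false); [|lia]
        | rewrite (_ : (a == b)%N = true); [|lia]] end.

(** The seven functions 1, k^(q^j), k^(q^j + q^(j+1)) are linearly independent
    on the elements of given norm, for every q >= 2: as polynomials in k they
    have distinct degrees smaller than n. *)
Lemma normic_poly_eq0 (r k0 c0 : L) (c1 c2 : 'I_3 -> L) :
    n.-primitive_root r -> k0 != 0 ->
    (forall k, k ^+ n = k0 ^+ n ->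
       c0 + \sum_j c1 j * frob j k
          + \sum_j c2 j * (frob j k * frob (j + 1) k) = 0) ->
  [/\ c0 = 0, forall j, c1 j = 0 & forall j, c2 j = 0].
Proof.
move=> prim_r k0_neq0 vanish.
pose p : {poly L} := c0%:P
  + (c1 0 *: 'X + c1 1 *: 'X^q + c1 (-1) *: 'X^(q * q))
  + (c2 0 *: 'X^(1 + q) + c2 1 *: 'X^(q + q * q) + c2 (-1) *: 'X^(q * q + 1)).
have q_gt1 := q_gt1; have qq : (2 * q <= q * q)%N by nia.
have coefp m : p`_m = c0 * (m == 0)%:R + (c1 0 * (m == 1)%:R
    + c1 1 * (m == q)%:R + c1 (-1) * (m == (q * q)%N)%:R)
    + (c2 0 * (m == (1 + q)%N)%:R + c2 1 * (m == (q + q * q)%N)%:R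
    + c2 (-1) * (m == (q * q + 1)%N)%:R).
  by rewrite /p !coefE; case: (m == 0)%N; rewrite ?mulr1 ?mulr0.
have p0 : p = 0.
  apply: (poly_vanish prim_r k0_neq0) => [|i].
    apply/leq_sizeP => m mn; rewrite coefp; nat_eqs.
    by rewrite !mulr0 !addr0.
  have := vanish (k0 * r ^+ i).
  rewrite exprMn exprAC (prim_expr_order prim_r) expr1n mulr1 => /(_ erefl) <-.
  move: (k0 * r ^+ i) => k.
  have f1 : frob 1 k = k ^+ q by rewrite /frob expn1.
  have f2 : frob (-1) k = k ^+ (q * q) by rewrite /frob -mulnn.
  rewrite !(sum_ord3 0) !add0r ord3_11 addNr !frob0 f1 f2 /p.
  rewrite !(hornerD, hornerC, hornerZ, hornerXn, hornerX) !exprD; ring.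
have coef0 m : p`_m = 0 by rewrite p0 coef0.
move: (coef0 0%N) (coef0 1%N) (coef0 q) (coef0 (q * q)%N) (coef0 (1 + q)%N)
  (coef0 (q + q * q)%N) (coef0 (q * q + 1)%N); rewrite !coefp.
nat_eqs; rewrite !(mulr0, mulr1, addr0, add0r).
move=> e0 e10 e11 e12 e20 e21 e22.
by split=> // j; case: (ord3P j) => ->.
Qed.

Lemma cform_frob m (c : 'cV[L]_m) i j w :
  cform c (i + j) (map_mx (frob i) w) = frob i (cform c j w).
Proof.
by rewrite /cform map_frobD -map_mxM mxE.
Qed.

Lemma val_formE m (c : 'cV[L]_m) (v : 'rV[F]_m) :
  val_form c v = (map_mx (in_alg L) v *m c) 0 0.
Proof. by rewrite /val_form /cform map_frob0. Qed.

Lemma cform_in_alg m (c : 'cV[L]_m) j v :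
  cform c j (map_mx (in_alg L) v) = frob j (val_form c v).
Proof.
rewrite /val_form -cform_frob addr0; congr cform.
by apply/matrixP => a b; rewrite !mxE frob_in_alg.
Qed.

(** When the number of conjugate forms is the dimension, they are a coordinate
    system. *)
Lemma moore_surj m r (C : 'M[L]_(m, r)) : m = (3 * r)%N ->
    (forall v : 'rV[F]_m, map_mx (in_alg L) v *m C = 0 -> v = 0) ->
  forall Y : 'I_3 -> 'rV[L]_r, exists w, forall j, w *m map_mx (frob j) C = Y j.
Proof.
move=> dim_m Cinj Y.
pose f (w : 'rV[L]_m) : 'M[L]_(3, r) := \matrix_j (w *m map_mx (frob j) C).
have f_linear : linear f.
  move=> a w w'; apply/row_matrixP => j.
  by rewrite linearD linearZ /= !rowK mulmxDl -scalemxAl.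
pose fL : {linear 'rV[L]_m -> 'M[L]_(3, r)} :=
  HB.pack f (GRing.isLinear.Build _ _ _ _ f f_linear).
have ker0 : lker (linfun fL) = 0%VS.
  apply/eqP; rewrite -subv0; apply/subvP => w; rewrite memv_ker lfunE memv0 /=.
  move/eqP/row_matrixP => fw; apply/eqP/(moore_kernel Cinj) => j.
  by have := fw j; rewrite rowK row0.
have imf : limg (linfun fL) = fullv.
  have := limg_ker_dim (linfun fL) fullv; rewrite capfv ker0 dimv0 add0n => dimf.
  by apply/eqP; rewrite eqEdim subvf dimf !dimvf /dim /= mul1n dim_m leqnn.
have : \matrix_j Y j \in limg (linfun fL) by rewrite imf memvf.
case/memv_imgP => w _; rewrite lfunE /= => /row_matrixP wY; exists w => j.
by have := wY j; rewrite !rowK.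
Qed.

(** A vector whose conjugate coordinates are conjugate is fixed by frob 1, so it
    is a base vector. *)
Lemma moore_surj_base m r (C : 'M[L]_(m, r)) : m = (3 * r)%N ->
    (forall v : 'rV[F]_m, map_mx (in_alg L) v *m C = 0 -> v = 0) ->
  forall y : 'rV[L]_r, exists v : 'rV[F]_m, map_mx (in_alg L) v *m C = y.
Proof.
move=> dim_m Cinj y.
have [w wP] := moore_surj dim_m Cinj (fun j => map_mx (frob j) y).
have fixw : map_mx (frob 1) w = w.
  apply/eqP; rewrite -subr_eq0; apply/eqP; apply: (moore_kernel Cinj) => j.
  rewrite mulmxBl wP -[j](subrKC 1); move: (j - 1) => i.
  by rewrite !map_frobD -map_mxM wP subrr.
have wF i : exists a, w 0 i == in_alg L a.
  have /frob_fixed [a ->] : frob 1 (w 0 i) = w 0 i by rewrite -{2}fixw mxE.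
  by exists a.
exists (\row_i xchoose (wF i)).
have -> : map_mx (in_alg L) (\row_i xchoose (wF i)) = w.
  by apply/rowP => i; rewrite !mxE; apply/esym/eqP/(xchooseP (wF i)).
by have := wP 0; rewrite !map_frob0.
Qed.

(** * The planes y = k z^(q^e) *)

Section SpreadCoordinates.
(* The coordinates y and z of F^6 = L^2. *)
Variables eta zeta : 'cV[L]_6.
Hypothesis val_inj0 : forall v : 'rV[F]_6,
  val_form eta v = 0 -> val_form zeta v = 0 -> v = 0.

Let C : 'M[L]_(6, 1 + 1) := row_mx eta zeta.

Let cform_row_mx j (w : 'rV[L]_6) : w *m map_mx (frob j) C =
  row_mx (cform eta j w)%:M (cform zeta j w)%:M.
Proof. by rewrite /C map_row_mx mul_mx_row; congr row_mx; apply: mx11_scalar. Qed.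

Let C_inj (v : 'rV[F]_6) : map_mx (in_alg L) v *m C = 0 -> v = 0.
Proof.
have := cform_row_mx 0 (map_mx (in_alg L) v).
rewrite map_frob0 => -> /matrixP C0; apply: val_inj0.
  by have := C0 0 (lshift 1 0); rewrite row_mxEl !mxE.
by have := C0 0 (rshift 1 0); rewrite row_mxEr !mxE.
Qed.

Lemma cform_inj0 (w : 'rV[L]_6) :
  (forall j, cform eta j w = 0) -> (forall j, cform zeta j w = 0) -> w = 0.
Proof.
move=> weta wzeta; apply: (moore_kernel C_inj) => j.
by rewrite cform_row_mx weta wzeta !raddf0 row_mx0.
Qed.

Lemma cform_surj (y z : 'I_3 -> L) :
  exists w : 'rV[L]_6, forall j, cform eta j w = y j /\ cform zeta j w = z j.
Proof.
have [w wP] := @moore_surj 6 (1 + 1) C (erefl _) C_inj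
  (fun j => row_mx (y j)%:M (z j)%:M).
exists w => j; have /matrixP := wP j; rewrite cform_row_mx => wj; split.
  by have := wj 0 (lshift 1 0); rewrite !row_mxEl !mxE.
by have := wj 0 (rshift 1 0); rewrite !row_mxEr !mxE.
Qed.

Lemma val_form_surj (y z : L) :
  exists v : 'rV[F]_6, val_form eta v = y /\ val_form zeta v = z.
Proof.
have [v vP] := @moore_surj_base 6 (1 + 1) C (erefl _) C_inj
  (row_mx y%:M z%:M).
exists v; have := cform_row_mx 0 (map_mx (in_alg L) v).
rewrite map_frob0 vP => /matrixP wj; split.
  by have := wj 0 (lshift 1 0); rewrite !row_mxEl !mxE.
by have := wj 0 (rshift 1 0); rewrite !row_mxEr !mxE.
Qed.

Definition plane_eq e k (v : 'rV[F]_6) : L :=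
  val_form eta v - k * frob e (val_form zeta v).

Lemma plane_eq_is_linear e k : linear (plane_eq e k).
Proof.
move=> a v v'; rewrite /plane_eq !linearP /=.
rewrite -(mulr_algl a (val_form zeta v)) rmorphD rmorphM /= -in_algE frob_in_alg.
by rewrite mulrDr mulrCA mulr_algl scalerBr opprD addrACA.
Qed.

HB.instance Definition _ e k :=
  GRing.isLinear.Build F 'rV[F]_6 L *:%R (plane_eq e k) (plane_eq_is_linear e k).

Definition plane e k : {vspace 'rV[F]_6} := lker (linfun (plane_eq e k)).

Lemma mem_plane e k v :
  reflect (val_form eta v = k * frob e (val_form zeta v)) (v \in plane e k).
Proof.
by rewrite memv_ker lfunE /= /plane_eq subr_eq0; apply: eqP.
Qed.

Lemma dim_plane e k : \dim (plane e k) = 3%N.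
Proof.
have := limg_ker_dim (linfun (plane_eq e k)) fullv; rewrite capfv.
have -> : limg (linfun (plane_eq e k)) = fullv.
  apply/vspaceP => y; rewrite memvf; apply/memv_imgP.
  have [v [vy vz]] := val_form_surj y 0.
  by exists v; rewrite ?memvf // lfunE /= /plane_eq vy vz rmorph0 mulr0 subr0.
by rewrite dimL dimvf /dim /= mul1n => /(@addIn 3 _ 3).
Qed.

Lemma plane_inj e : injective (plane e).
Proof.
move=> k k' eqP; have [v [vy vz]] := val_form_surj k 1.
have: v \in plane e k by apply/mem_plane; rewrite vy vz rmorph1 mulr1.
by rewrite eqP => /mem_plane; rewrite vy vz rmorph1 mulr1.
Qed.

Lemma mem_plane_eq0 e k v : v \in plane e k -> val_form zeta v = 0 -> v = 0.
Proof.
by move=> /mem_plane vy vz; apply: val_inj0; rewrite // vy vz rmorph0 mulr0.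
Qed.

Lemma plane_cap0 e k k' : k != k' -> (plane e k :&: plane e k' = 0)%VS.
Proof.
move=> neqk; apply/eqP; rewrite -subv0; apply/subvP => v.
rewrite memv_cap memv0 => /andP [vP /mem_plane vk'].
have /mem_plane vk := vP.
have /eqP : (k - k') * frob e (val_form zeta v) = 0.
  by rewrite mulrBl -vk -vk' subrr.
rewrite mulf_eq0 subr_eq0 (negPf neqk) fmorph_eq0 /= => /eqP vz.
exact/eqP/(mem_plane_eq0 vP).
Qed.

Lemma dim_plane_cap e e' k k' : e != e' -> k != 0 -> k ^+ n = k' ^+ n ->
  \dim (plane e k :&: plane e' k') = 1%N.
Proof.
move=> neq_e k0 kn; have [z z0 zE] := twisted_hilbert90 neq_e k0 kn.
have [v [vy vz]] := val_form_surj (k * frob e z) z.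
have v0 : v != 0 by apply: contraNneq z0 => v0; rewrite -vz v0 linear0.
suff -> : (plane e k :&: plane e' k' = <[v]>)%VS by rewrite dim_vline v0.
apply/vspaceP => w; rewrite memv_cap; apply/andP/vlineP => [[]|[a ->]]; last first.
  by rewrite !memvZ //; apply/mem_plane; rewrite vy vz.
move=> wP wP'; have /mem_plane wk := wP; have /mem_plane wk' := wP'.
have [a xa] : exists a, val_form zeta w / z = in_alg L a.
  apply: (frob_eq_scalar neq_e); rewrite !fmorph_div /=; apply/eqP.
  rewrite eqr_div ?fmorph_eq0 //; apply/eqP/(mulfI k0).
  by rewrite [LHS]mulrA -wk wk' [RHS]mulrCA zE; ring.
exists a; apply/eqP; rewrite -subr_eq0; apply/eqP/(@mem_plane_eq0 e k).
  by rewrite rpredB ?memvZ //; apply/mem_plane; rewrite vy vz.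
by rewrite linearB linearZ /= vz -mulr_algl -in_algE -xa divfK ?subrr.
Qed.

(** The k0 r^i, for r a primitive n-th root of unity, are the elements with the
    norm of k0. *)
Definition norm_class r k0 e : {fset {vspace 'rV[F]_6}} :=
  [fset plane e (k0 * r ^+ i) | i : 'I_n in 'I_n]%fset.

Variables r k0 : L.
Hypotheses (prim_r : n.-primitive_root r) (k0_neq0 : k0 != 0).

Lemma mem_norm_class e W : reflect
  (exists2 k, k ^+ n = k0 ^+ n & W = plane e k) (W \in norm_class r k0 e).
Proof.
apply: (iffP (imfsetP _ _ _ _)) => [[i _ ->]|[k kn ->]].
  exists (k0 * r ^+ i) => //.
  by rewrite exprMn exprAC (prim_expr_order prim_r) expr1n mulr1.
have /(prim_rootP prim_r) [i ki] : (k / k0) ^+ n = 1.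
  by rewrite expr_div_n kn divff // expf_neq0.
by exists i; rewrite // -ki mulrCA divff // mulr1.
Qed.

Lemma card_norm_class e : #|` norm_class r k0 e|%fset = n.
Proof.
rewrite card_imfset => [|i j /plane_inj /(mulfI k0_neq0)/eqP].
  by rewrite -cardE card_ord.
by rewrite (eq_prim_root_expr prim_r) !modn_small // => /eqP/val_inj.
Qed.

(** Since frob e preserves the norm, the point set does not depend on e. *)
Lemma covered_norm_class e v : v != 0 ->
  covered (norm_class r k0 e) <[v]>%VS <->
  val_form eta v ^+ n = (k0 * val_form zeta v) ^+ n.
Proof.
move=> v0; split=> [[W /mem_norm_class [k kn ->]]|vn].
  rewrite -memvE => /mem_plane ->.
  by rewrite !exprMn kn; congr (_ * _); apply: frob_expr.
have z0 : val_form zeta v != 0.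
  apply: contraNneq v0 => vz; apply/eqP/val_inj0 => //; apply/eqP.
  by move: vn; rewrite vz mulr0 expr0n addn1 => /eqP; rewrite expf_eq0.
exists (plane e (val_form eta v / frob e (val_form zeta v))).
  apply/mem_norm_class; eexists; last by [].
  rewrite expr_div_n vn exprMn frob_expr mulfK // expf_neq0 //.
by rewrite -memvE; apply/mem_plane; rewrite divfK // fmorph_eq0.
Qed.

Lemma switching_norm_class e e' : e != e' ->
  switching_set (norm_class r k0 e) (norm_class r k0 e').
Proof.
move=> neq_e; split.
- exact: card_norm_class.
- by move=> _ /mem_norm_class [k _ ->]; exact: dim_plane.
- move=> _ _ /mem_norm_class [k _ ->] /mem_norm_class [k' _ ->] neq_k.
  by apply: plane_cap0; apply: contraNneq neq_k => ->.
- by move=> P /dim1_line [P0 ->]; rewrite !covered_norm_class.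
move=> _ _ /mem_norm_class [k kn ->] /mem_norm_class [k' k'n ->].
apply: dim_plane_cap; rewrite ?kn ?k'n //.
by have := expf_neq0 n k0_neq0; rewrite -kn expf_eq0 addn1.
Qed.

(** Every F-linear map L -> L is a linearised polynomial: the Moore matrix of
    the z-coordinates of a basis of W has independent rows, so some combination
    of its columns gives the y-coordinates. *)
Lemma linearized_graph (W : {vspace 'rV[F]_6}) :
    (forall v, v \in W -> val_form zeta v = 0 -> v = 0) ->
  exists A : 'I_3 -> L, forall v, v \in W ->
    val_form eta v = \sum_j A j * frob j (val_form zeta v).
Proof.
move=> Winj; pose b := vbasis W; pose m := \dim W.
pose c : 'cV[L]_m := \col_i val_form zeta b`_i.
pose M : 'M[L]_(m, 3) := \matrix_(i, j) frob j (c i 0).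
have /row_freeP [M' MM'] : row_free M.
  rewrite -kermx_eq0; apply/rowV0P => w /sub_kermxP wM.
  apply: (moore_kernel (H := c)) => [s sc|j]; last first.
    apply/rowP => i; rewrite ord1 [RHS]mxE; have /rowP/(_ j) := wM.
    rewrite !mxE => wMj; rewrite -[RHS]wMj.
    by apply: eq_bigr => k _; rewrite !mxE.
  have : \sum_i s 0 i *: b`_i = 0.
    apply: Winj.
      rewrite memv_suml // => i _.
      by rewrite memvZ // vbasis_mem // mem_nth ?size_tuple.
    have /rowP/(_ 0) := sc; rewrite !mxE => <-; rewrite linear_sum.
    by apply: eq_bigr => i _; rewrite linearZ !mxE /= mulr_algl.
  move=> sb0; have /freeP s0 := basis_free (vbasisP W); have {}s0 := s0 _ sb0.
  by apply/rowP => i; rewrite mxE s0.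
pose u := M' *m \col_i val_form eta b`_i; exists (fun j => u j 0) => v vW.
have bE (i : 'I_m) :
    val_form eta b`_i = \sum_j u j 0 * frob j (val_form zeta b`_i).
  have : (M *m u) i 0 = val_form eta b`_i by rewrite mulmxA MM' mul1mx mxE.
  by rewrite mxE => <-; apply: eq_bigr => j _; rewrite !mxE mulrC.
rewrite (coord_vbasis vW) !linear_sum /=.
under [RHS]eq_bigr do rewrite rmorph_sum mulr_sumr.
rewrite exchange_big; apply: eq_bigr => i _; rewrite !linearZ /= bE scaler_sumr.
apply: eq_bigr => j _.
rewrite -(mulr_algl _ (val_form zeta _)) rmorphM /= -in_algE frob_in_alg.
by rewrite mulrCA mulr_algl.
Qed.

(** The equation and its two conjugates are a singular linear system in z, z^q,
    z^(q^2).  Expanding its determinant in k, the coefficient of k^(q^2 + q) is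
    A_0, and for A_0 = 0 that of k is (A_1 A_2^q)^q. *)
Lemma dickson_singular (A : 'I_3 -> L) :
    (forall k, k ^+ n = k0 ^+ n ->
       exists2 z, z != 0 & \sum_j A j * frob j z = k * z) ->
  A 0 = 0 /\ A 1 * A (-1) = 0.
Proof.
move=> Asing.
pose a i := frob i (A 0); pose b i := frob i (A 1); pose d i := frob i (A (-1)).
pose c0 := a 0 * a 1 * a (-1) + b 0 * b 1 * b (-1) + d 0 * d 1 * d (-1)
  - k0 ^+ n - a 0 * b 1 * d (-1) - a (-1) * b 0 * d 1 - a 1 * d 0 * b (-1).
pose c1 j := b (j + 1) * d (j - 1) - a (j + 1) * a (j - 1).
have [|_ c1_0 a_0] :=
  @normic_poly_eq0 r k0 c0 c1 (fun j => a (j - 1)) prim_r k0_neq0.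
  move=> k kn; have [z z0 zE] := Asing k kn.
  have singular i : (a i - frob i k) * frob i z + b i * frob (i + 1) z
      + d i * frob (i - 1) z = 0.
    have := congr1 (frob i) zE; rewrite (sum_ord3 0) !add0r frob0.
    rewrite !rmorphD !rmorphM /= -!frobD -/(a i) -/(b i) -/(d i) => zEi.
    by rewrite mulrBl -zEi; ring.
  have := singular 0; have := singular 1; have := singular (-1).
  rewrite !add0r ord3_11 ord3_N11 subrr addNr !frob0 => e2 e1 e0.
  rewrite -[RHS](det3_eq0 z0 e0 e1 e2) /c1 /c0 !(sum_ord3 0) !add0r ord3_11.
  rewrite ord3_N11 subrr addNr -kn expr_n !frob0; ring.
have a0 : A 0 = 0 by have := a_0 1; rewrite /a subrr frob0.
split=> //; have /eqP := c1_0 0.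
rewrite /c1 !add0r /a a0 !rmorph0 mulr0 subr0 /b /d mulf_eq0 !fmorph_eq0.
by rewrite -mulf_eq0 => /eqP.
Qed.

(** The planes of B are in class 1 or -1 by [dickson_singular]; planes of the
    two classes meet in a point, so disjointness puts all of B in one of them,
    and B exhausts it by cardinality. *)
Lemma switching_norm_class_unique B : switching_set (norm_class r k0 0) B ->
  B = norm_class r k0 1 \/ B = norm_class r k0 (-1).
Proof.
case=> cardB dimB disjB covB meetB.
have pointB W v : W \in B -> v \in W -> v != 0 ->
    val_form eta v ^+ n = (k0 * val_form zeta v) ^+ n.
  move=> WB vW v0; apply/(covered_norm_class 0 v0)/covB.
    by rewrite dim_vline v0.
  by exists W; rewrite // -memvE.
have injB W v : W \in B -> v \in W -> val_form zeta v = 0 -> v = 0.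
  move=> WB vW vz; have [//|v0] := eqVneq v 0; apply: val_inj0 => //.
  have := pointB W v WB vW v0; rewrite vz mulr0 expr0n addn1 => /eqP.
  by rewrite expf_eq0 => /eqP.
have famB W : W \in B -> W \in norm_class r k0 1 \/ W \in norm_class r k0 (-1).
  move=> WB; have [A AW] := linearized_graph (injB W ^~ WB).
  have [|A0 A12] := @dickson_singular A.
    move=> k kn; have /meetB/(_ WB)/dim1_line [] : plane 0 k \in norm_class r k0 0.
      by apply/mem_norm_class; exists k.
    set v := vpick _ => v0 capE; have : v \in (plane 0%R k :&: W)%VS.
      by rewrite capE memv_line.
    rewrite memv_cap => /andP [/mem_plane vk vW]; exists (val_form zeta v).
      by apply: contraNneq v0 => /(injB W _ WB vW) ->.
    by rewrite -AW // vk frob0.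
  have famE e :
      (forall v, v \in W -> val_form eta v = A e * frob e (val_form zeta v)) ->
      W \in norm_class r k0 e.
    move=> We; apply/mem_norm_class; exists (A e); last first.
      apply/eqP; rewrite eqEdim dim_plane dimB // leqnn andbT.
      by apply/subvP => v vW; apply/mem_plane/We.
    have W0 : vpick W != 0 by rewrite vpick0 -dimv_eq0 dimB.
    have z0 : val_form zeta (vpick W) != 0.
      by apply: contraNneq W0 => /(injB W _ WB (memv_pick W)) ->.
    apply: (mulIf (expf_neq0 n z0)).
    rewrite -[RHS]exprMn -(pointB W _ WB (memv_pick W) W0) (We _ (memv_pick W)).
    by rewrite exprMn; congr (_ * _); rewrite frob_expr.
  move/eqP: A12; rewrite mulf_eq0 => /orP [/eqP A1|/eqP A2]; [right|left];
    apply: famE => v /AW ->; rewrite (sum_ord3 0) !add0r A0 mul0r add0r.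
    by rewrite A1 mul0r add0r.
  by rewrite A2 mul0r addr0.
have [W0 W0B] : exists W, W \in B.
  by apply/fset0Pn; rewrite -cardfs_gt0 cardB addn1.
have subE (e : 'I_3) : (forall W, W \in B -> W \in norm_class r k0 e) ->
    B = norm_class r k0 e.
  move=> /fsubsetP sub; apply/eqP.
  by rewrite eqEfcard sub card_norm_class cardB leqnn.
have one_norm_class i j W1 W2 : i != j -> W1 \in B -> W2 \in B ->
    W1 \in norm_class r k0 i -> W2 \in norm_class r k0 j -> False.
  move=> neq_e WB W'B We We'.
  have [_ _ _ _ /(_ W1 W2 We We')] := switching_norm_class neq_e.
  have [->|neqW] := eqVneq W1 W2; first by rewrite capvv dimB.
  by rewrite disjB // dimv0.
case: (famB _ W0B) => [] W0e; [left|right]; apply: subE => W WB;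
  case: (famB W WB) => // We; exfalso.
  exact: (one_norm_class 1 (-1) W0 W).
exact: (one_norm_class 1 (-1) W W0).
Qed.

Lemma covers_norm_class :
  covers_of (norm_class r k0 0) (norm_class r k0 1) (norm_class r k0 (-1)).
Proof.
split=> [B|]; last exact: switching_norm_class.
by split=> [/switching_norm_class_unique //|[] ->]; apply: switching_norm_class.
Qed.

(** * Transversal lines *)

(** The converse is by descent: a vector that satisfies the conjugate equations
    has its traces in the plane. *)
Lemma mem_extended_plane e k (w : 'rV[L]_6) :
  w \in map_vspace (in_alg L) (plane e k) <->
  forall j, cform eta j w = frob j k * cform zeta (j + e) w.
Proof.
split=> [wP j|wP].
  rewrite (@coord_span _ _ _
    (map_tuple (map_mx (in_alg L)) (vbasis (plane e k))) w wP).
  rewrite !linear_sum mulr_sumr; apply: eq_bigr => i _.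
  rewrite !linearZ /= mulrCA; congr (_ * _).
  rewrite (nth_map 0) ?size_tuple // !cform_in_alg.
  have /mem_plane -> : (vbasis (plane e k))`_i \in plane e k.
    by rewrite vbasis_mem // mem_nth ?size_tuple.
  by rewrite rmorphM frobD.
apply: trace_descent => t; apply: mem_map_vspace; apply/mem_plane.
have val_trace c :
    val_form c (trace_mx (t *: w)) = \sum_j frob j (t * cform c (- j) w).
  rewrite /val_form trace_mxE linear_sum; apply: eq_bigr => j _.
  by rewrite -[X in cform _ X _ = _](subrr j) cform_frob linearZ.
rewrite !val_trace rmorph_sum mulr_sumr [RHS](reindex_inj (addrI (- e))).
apply: eq_bigr => j _; rewrite /= -[in RHS]frobD addNKr.
by rewrite wP !rmorphM /= -frobD subrr frob0 opprD opprK [- j + e]addrC; ring.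
Qed.

(** The pairs (true, j), (false, j) index the two coordinates Y_j and Z_(j+e)
    that the equations of the extended planes relate. *)
Definition coordinate e (p : bool * 'I_3) w : L :=
  if p.1 then cform eta p.2 w else cform zeta (p.2 + e) w.

Arguments coordinate : simpl never.

Lemma coordinate_is_linear e p : linear_for *%R (coordinate e p).
Proof. by move=> a w w'; rewrite /coordinate; case: p.1; rewrite linearP. Qed.

HB.instance Definition _ e p := GRing.isLinear.Build L 'rV[L]_6 L *%R
  (coordinate e p) (coordinate_is_linear e p).

Lemma coordinate_inj0 e w : (forall p, coordinate e p w = 0) -> w = 0.
Proof.
move=> w0; apply: cform_inj0 => j; first exact: (w0 (true, j)).
by have := w0 (false, j - e); rewrite /coordinate /= subrK.
Qed.

Lemma coordinate_surj e (x : bool * 'I_3 -> L) :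
  exists w, forall p, coordinate e p w = x p.
Proof.
have [w wP] := cform_surj (fun j => x (true, j)) (fun j => x (false, j - e)).
exists w => -[[] j]; rewrite /coordinate /=; first by case: (wP j).
by have [_ ->] := wP (j + e); rewrite addrK.
Qed.

Definition coordinate_line e i (g : {vspace 'rV[L]_6}) : Prop :=
  \dim g = 2%N /\
  forall w, w \in g <-> forall p, p.2 != i -> coordinate e p w = 0.

Lemma coordinate_line_ex e i : exists g, coordinate_line e i g.
Proof.
have [w1 w1E] := coordinate_surj e (fun p => (p == (true, i))%:R).
have [w2 w2E] := coordinate_surj e (fun p => (p == (false, i))%:R).
have free12 : free [:: w1; w2].
  rewrite free_cons span_seq1 seq1_free; apply/andP; split.
    apply/vlineP => -[a w1a]; have := w1E (true, i).
    rewrite w1a linearZ /= w2E mulr0.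
    by move/esym/eqP; rewrite eqxx oner_eq0.
  apply: contraTneq isT => w20; have := w2E (false, i).
  by rewrite w20 linear0 eqxx => /esym/eqP; rewrite oner_eq0.
exists <<[:: w1; w2]>>%VS; split; first by move/eqP: free12.
move=> w; rewrite span_cons span_seq1; split=> [|wi].
  case/memv_addP=> _ /vlineP [a ->] [_ /vlineP [b ->] ->] [s j] /= ji.
  rewrite linearD !linearZ /= w1E w2E !xpair_eqE (negPf ji).
  by rewrite !andbF !mulr0 addr0.
have -> : w = coordinate e (true, i) w *: w1 + coordinate e (false, i) w *: w2.
  apply/eqP; rewrite -subr_eq0; apply/eqP/(coordinate_inj0 (e := e)) => p.
  rewrite linearB linearD !linearZ /= w1E w2E; case: p => -[] j;
    rewrite !xpair_eqE /= ?(mulr0, addr0, add0r);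
    have [->|/(wi (_, _)) ->] := eqVneq j i;
    by rewrite ?(mulr1, mulr0) subrr.
by rewrite memv_add ?memvZ ?memv_line.
Qed.

Lemma coordinate_line_unique e i g g' :
  coordinate_line e i g -> coordinate_line e i g' -> g = g'.
Proof.
move=> [_ gP] [_ g'P]; apply/vspaceP => w.
by apply/idP/idP => [/gP/g'P|/g'P/gP].
Qed.

Lemma coordinate_line_inj e i i' g :
  coordinate_line e i g -> coordinate_line e i' g -> i = i'.
Proof.
move=> [_ gP] [_ gP']; apply: contraTeq isT => neq_i.
have [w wE] := coordinate_surj e (fun p => (p == (true, i))%:R).
have /gP/gP'/(_ (true, i) neq_i) : forall p, p.2 != i -> coordinate e p w = 0.
  by move=> [s j] /= ji; rewrite wE xpair_eqE (negPf ji) andbF.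
by rewrite wE eqxx => /eqP; rewrite oner_eq0.
Qed.

(** Conjugation shifts the indices of the coordinates by one. *)
Lemma conjugate_coordinate_line e i g :
  coordinate_line e i g -> coordinate_line e (i + 1) (conjugate g).
Proof.
move=> gP; have [g' g'P] := coordinate_line_ex e (i + 1).
have frob_coordinate p w a : coordinate e (p, a + 1) (map_mx (frob 1) w)
    = frob 1 (coordinate e (p, a) w).
  rewrite /coordinate /= -addrA [1 + e]addrC addrA ![_ + 1]addrC.
  by rewrite !cform_frob; case: p.
suff -> : conjugate g = g' by [].
have conjE : conjugate g = map_vspace (frob 1) g by [].
apply/eqP; rewrite conjE eqEsubv; apply/andP; split.
  apply: map_vspace_sub => w /(proj2 gP) wg; apply/(proj2 g'P) => -[s j] /= ji.
  rewrite -[j](subrK 1) frob_coordinate wg ?rmorph0 //=.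
  by apply: contraNneq ji => <-; rewrite subrK.
apply/subvP => w /(proj2 g'P) wg.
rewrite -[w](map_frobNK 1); apply: mem_map_vspace; apply/(proj2 gP) => -[s j] /= ji.
apply: (fmorph_inj (frob 1)); rewrite /= -frob_coordinate rmorph0.
rewrite map_frobNK.
by apply: wg; apply: contraNneq ji => /addIr ->.
Qed.

(** The point Y_i = k^(q^i), Z_(i+e) = 1 of the line is in the extension of
    y = k z^(q^e). *)
Lemma coordinate_line_transversal e i g :
  coordinate_line e i g -> Defs.transversal (norm_class r k0 e) g.
Proof.
move=> [dimg gP]; split=> // _ /mem_norm_class [k kn ->].
have [w wE] := coordinate_surj e (fun p => if p.2 == i then
  (if p.1 then frob i k else 1) else 0).
have w0 : w != 0.
  apply: contraTneq isT => w0; have := wE (false, i).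
  by rewrite w0 linear0 eqxx => /esym/eqP; rewrite oner_eq0.
have wg : w \in g by apply/gP => p pi; rewrite wE (negPf pi).
have wP : w \in map_vspace (in_alg L) (plane e k).
  apply/mem_extended_plane => j; have := wE (true, j); have := wE (false, j).
  rewrite /coordinate /= => -> ->; case: eqP => [->|]; rewrite ?mulr1 ?mulr0 //.
by apply: contraNneq w0 => cap0; rewrite -memv0 -cap0 memv_cap wg.
Qed.

(** Membership of a u + b u' makes the 2 x 2 minors of the vectors
    Y_j - k^(q^j) Z_(j+e) taken at u and u' vanish.  As functions of k they are
    covered by [normic_poly_eq0], and their coefficients are the minors of the
    coordinates of u and u' in different pairs. *)
Lemma pencil_minors e (u u' : 'rV[L]_6) :
    (forall k, k ^+ n = k0 ^+ n -> exists a b, (a, b) != (0, 0) /\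
       a *: u + b *: u' \in map_vspace (in_alg L) (plane e k)) ->
  forall p p', p.2 != p'.2 ->
    coordinate e p u * coordinate e p' u' =
    coordinate e p' u * coordinate e p u'.
Proof.
move=> meet.
pose c := coordinate e.
pose minor p p' := c p u * c p' u' - c p' u * c p u'.
suff minor0 i s s' : minor (s, i) (s', i + 1) = 0.
  move=> [s i] [s' j] /= neq_ij; apply/eqP; rewrite -subr_eq0; apply/eqP.
  have : j - i != 0 by rewrite subr_eq0 eq_sym.
  case: (ord3P (j - i)) => /eqP; first by move->.
    by rewrite subr_eq addrC => /eqP -> _; apply: minor0.
  rewrite subr_eq addrC => /eqP jE _; have iE : i = j + 1 by rewrite jE subrK.
  by rewrite iE -opprB; apply/eqP; rewrite oppr_eq0; apply/eqP; apply: minor0.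
pose c0 := minor (true, i) (true, i + 1).
pose c1 j := if j == i then - minor (false, i) (true, i + 1)
  else if j == i + 1 then - minor (true, i) (false, i + 1) else 0.
pose c2 j := if j == i then minor (false, i) (false, i + 1) else 0.
have ii : (i + 1 == i) = false by rewrite -subr_eq0 addrAC subrr.
have iN : (i - 1 == i) = false by rewrite -subr_eq0 addrAC subrr.
have iiN : (i - 1 == i + 1) = false by rewrite -subr_eq0 opprD addrACA subrr.
have [|c0E c1E c2E] := @normic_poly_eq0 r k0 c0 c1 c2 prim_r k0_neq0.
  move=> k kn; rewrite !(sum_ord3 i) /c1 /c2 eqxx ii iN iiN eqxx !mul0r !addr0.
  have [a [b [ab0 /mem_extended_plane kP]]] := meet k kn.
  have kc j : a * (c (true, j) u - frob j k * c (false, j) u)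
      + b * (c (true, j) u' - frob j k * c (false, j) u') = 0.
    have := kP j; rewrite !linearD !linearZ /= => kPj.
    rewrite !mulrBr addrACA /c /coordinate /= kPj; ring.
  have := kc i; have := kc (i + 1).
  set m1 := _ - _; set m1' := _ - _; set m0 := _ - _; set m0' := _ - _ => e1 e0.
  have : m0 * m1' - m1 * m0' = 0.
    move: ab0; rewrite xpair_eqE negb_and => /orP [a0|b0].
      apply: (mulfI a0); rewrite mulr0.
      rewrite -[RHS](_ : m1' * (a * m0 + b * m0') - m0' * (a * m1 + b * m1') = 0).
        ring.
      by rewrite e0 e1 !mulr0 subrr.
    apply: (mulfI b0); rewrite mulr0.
    rewrite -[RHS](_ : m0 * (a * m1 + b * m1') - m1 * (a * m0 + b * m0') = 0).
      ring.
    by rewrite e0 e1 !mulr0 subrr.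
  by move=> <-; rewrite /m0 /m0' /m1 /m1' /c0 /minor; ring.
case: s s' => -[].
- exact: c0E.
- by have /eqP := c1E (i + 1); rewrite /c1 ii eqxx oppr_eq0 => /eqP.
- by have /eqP := c1E i; rewrite /c1 eqxx oppr_eq0 => /eqP.
by have := c2E i; rewrite /c2 eqxx.
Qed.

(** By [pencil_minors] a nonzero Pluecker coordinate of the line involves only
    one pair i; the minors of this pair with the others then kill all
    coordinates outside it. *)
Lemma transversal_coordinate_line e h :
  Defs.transversal (norm_class r k0 e) h -> exists i, coordinate_line e i h.
Proof.
move=> [dimh hW]; have [u [u' [free_u hE]]] := dim2_basis dimh.
pose c := coordinate e.
have minors : forall p p', p.2 != p'.2 -> c p u * c p' u' = c p' u * c p u'.
  apply: pencil_minors => k kn.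
  have /hW : plane e k \in norm_class r k0 e.
    by apply/mem_norm_class; exists k.
  rewrite -vpick0; set w := vpick _ => w0.
  have : w \in (h :&: map_vspace (in_alg L) (plane e k))%VS by exact: memv_pick.
  rewrite memv_cap {1}hE span_cons span_seq1 => /andP [/memv_addP].
  case=> _ /vlineP [a ->] [_ /vlineP [b ->] wE] wP; exists a, b.
  rewrite -wE; split=> //; apply: contraNneq w0 => -[a0 b0].
  by rewrite wE a0 b0 !scale0r addr0.
have [p [p' pp']] : exists p p', c p u * c p' u' - c p' u * c p u' != 0.
  have [|all0] := boolP
      [exists p, [exists p', c p u * c p' u' - c p' u * c p u' != 0]].
    by case/existsP => p /existsP [p' ?]; exists p, p'.
  move: free_u; rewrite free_cons span_seq1 seq1_free => /andP [u_notin u'0].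
  have [p cp0] : exists p, c p u' != 0.
    have [/existsP //|/existsPn cu0] := boolP [exists p, c p u' != 0].
    by case/eqP: u'0; apply: (@coordinate_inj0 e) => p; apply/eqP/negbNE/cu0.
  have uE : c p u' *: u - c p u *: u' = 0.
    apply: (@coordinate_inj0 e) => p'; rewrite linearB !linearZ /=.
    move/existsPn/(_ p)/existsPn/(_ p')/negbNE/eqP: all0.
    by move/(congr1 -%R); rewrite oppr0 => <-; rewrite /c; ring.
  case/negP: u_notin; apply/vlineP; exists ((c p u') ^-1 * c p u).
  apply: (scalerI cp0); rewrite scalerA mulrA divff // mul1r.
  by apply/eqP; rewrite -subr_eq0 uE.
exists p.2.
have pp2 : p.2 = p'.2.
  apply/eqP; apply: contraNT pp' => neq_p; by rewrite minors // subrr.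
have zero_u x : x.2 != p.2 -> c x u = 0 /\ c x u' = 0.
  move=> xp; have xp' : x.2 != p'.2 by rewrite -pp2.
  have e1 := minors _ _ xp; have e2 := minors _ _ xp'.
  split; apply: (mulIf pp'); rewrite mul0r.
    rewrite -[RHS](_ : c p u * (c x u * c p' u' - c p' u * c x u')
      - c p' u * (c x u * c p u' - c p u * c x u') = 0); first ring.
    by rewrite e1 e2 !subrr !mulr0 subrr.
  rewrite -[RHS](_ : c p u' * (c x u * c p' u' - c p' u * c x u')
    - c p' u' * (c x u * c p u' - c p u * c x u') = 0); first ring.
  by rewrite e1 e2 !subrr !mulr0 subrr.
have [g gP] := coordinate_line_ex e p.2; suff -> : h = g by [].
apply/eqP; rewrite eqEdim dimh (proj1 gP) leqnn andbT hE.
apply/span_subvP => v; rewrite !inE => /orP [] /eqP ->;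
  by apply/(proj2 gP) => x /zero_u; case.
Qed.

Lemma transversals_norm_class e g :
  coordinate_line e 0 g -> transversals_of (norm_class r k0 e) g.
Proof.
move=> g0; have g1 := conjugate_coordinate_line g0.
have g2 := conjugate_coordinate_line g1; rewrite add0r in g1 g2.
have gP : forall i h, coordinate_line e i h ->
    h \in [:: g; conjugate g; conjugate (conjugate g)].
  move=> i h; rewrite !inE; case: (ord3P i) => -> hP.
  - by rewrite (coordinate_line_unique hP g0) eqxx.
  - by rewrite (coordinate_line_unique hP g1) eqxx orbT.
  by rewrite ord3_11 in g2; rewrite (coordinate_line_unique hP g2) eqxx !orbT.
split=> [|h]; last first.
  split=> [/transversal_coordinate_line [i]|]; first exact: gP.
  rewrite !inE => /or3P [] /eqP ->.
  - exact: coordinate_line_transversal g0.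
  - exact: coordinate_line_transversal g1.
  exact: coordinate_line_transversal g2.
rewrite /= !inE !negb_or !andbT -andbA; apply/and3P; split.
- by apply/eqP => gg; move: g1; rewrite -gg => /(coordinate_line_inj g0)/(congr1 val).
- by apply/eqP => gg; move: g2; rewrite -gg => /(coordinate_line_inj g0)/(congr1 val).
by apply/eqP => gg; move: g2; rewrite -gg => /(coordinate_line_inj g1)/(congr1 val).
Qed.

End SpreadCoordinates.

(** * Splashes and carriers *)

Lemma mem_line_infty (x : 'rV[L]_3) : (x \in line_infty L) = (x 0 ord_max == 0).
Proof.
rewrite memv_ker lfunE /=; apply/eqP/eqP => [/matrixP/(_ 0 0)|x0].
  by rewrite !mxE.
by apply/matrixP => i j; rewrite !mxE !ord1.
Qed.

(** The forms a1 and a2 are coordinates y and z on the line at infinity in which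
    the carriers E1 and E2 are z = 0 and y = 0, and in which the splash is
    N(y) = N(z). *)
Definition splash_coordinates (S : {fset {vspace 'rV[L]_3}})
    (E1 E2 : {vspace 'rV[L]_3}) (a1 a2 : 'cV[L]_3) : Prop :=
  [/\ forall x, x \in line_infty L ->
        (x *m a1) 0 0 = 0 -> (x *m a2) 0 0 = 0 -> x = 0,
      forall y z, exists2 x, x \in line_infty L &
        (x *m a1) 0 0 = y /\ (x *m a2) 0 0 = z,
      forall x, (x \in E1) = (x \in line_infty L) && ((x *m a2) 0 0 == 0),
      forall x, (x \in E2) = (x \in line_infty L) && ((x *m a1) 0 0 == 0) &
      (forall P, P \in S ->
        exists x, [/\ x != 0, x \in line_infty L & P = <[x]>%VS]) /\
      forall x, x != 0 -> x \in line_infty L ->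
        <[x]>%VS \in S <-> (x *m a1) 0 0 ^+ n = (x *m a2) 0 0 ^+ n].

Section Splash.
Variables (pi S : {fset {vspace 'rV[L]_3}}) (E1 E2 : {vspace 'rV[L]_3}).
Variable M : 'M[L]_3.
Hypotheses (Munit : M \in unitmx)
  (piP : forall P : {vspace 'rV[L]_3}, P \in pi <->
      exists2 U : {vspace 'rV[F]_3}, \dim U = 1%N &
        P = homography M (map_vspace (in_alg L) U))
  (ext : exterior pi).

Lemma mem_subplane P : P \in pi <->
  exists2 u : 'rV[F]_3, u != 0 & P = <[map_mx (in_alg L) u *m M]>%VS.
Proof.
split=> [/piP [U /dim1_line [u0 ->] ->]|[u u0 ->]].
  by eexists; first exact: u0; rewrite map_vspace_line homography_line.
apply/piP; exists <[u]>%VS; first by rewrite dim_vline u0.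
by rewrite map_vspace_line homography_line.
Qed.

(* In the frame of pi the line at infinity is lambda = 0, and U j is the j-th
   conjugate of this equation. *)
Let lambda : 'cV[L]_3 := col ord_max M.
Let U j (x : 'rV[L]_3) : L := cform lambda j (x *m invmx M).

Let U_linear j : linear_for *%R (U j).
Proof. by move=> a x y; rewrite /U mulmxDl -scalemxAl linearP. Qed.

HB.instance Definition _ j := GRing.isLinear.Build L 'rV[L]_3 L *%R
  (U j) (U_linear j).

Let U_base j (u : 'rV[F]_3) :
  U j (map_mx (in_alg L) u *m M) = frob j (val_form lambda u).
Proof. by rewrite /U mulmxK // cform_in_alg. Qed.

Let U0E x : U 0 x = x 0 ord_max.
Proof.
rewrite /U /cform map_frob0.
have -> : lambda = M *m delta_mx ord_max 0.
  by rewrite -colE.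
by rewrite mulmxA mulmxKV // -colE mxE.
Qed.

(* This is exteriority: no point of pi is on lambda = 0. *)
Let val_lambda_inj (u : 'rV[F]_3) : val_form lambda u = 0 -> u = 0.
Proof.
move=> u_lambda; have [//|u0] := eqVneq u 0.
have /ext : <[map_mx (in_alg L) u *m M]>%VS \in pi by apply/mem_subplane; exists u.
by rewrite -memvE mem_line_infty -U0E U_base u_lambda rmorph0 eqxx.
Qed.

Let lambda_inj (u : 'rV[F]_3) : map_mx (in_alg L) u *m lambda = 0 -> u = 0.
Proof.
by move=> u_lambda; apply: val_lambda_inj; rewrite val_formE u_lambda mxE.
Qed.

Let U_inj0 x : (forall j, U j x = 0) -> x = 0.
Proof.
move=> xU; rewrite -[x](mulmxKV Munit).
rewrite (moore_kernel lambda_inj (w := x *m invmx M)) ?mul0mx //.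
by move=> j; apply/matrixP => a b; rewrite !ord1 [RHS]mxE; apply: xU.
Qed.

Let U_surj (y : 'I_3 -> L) : exists x, forall j, U j x = y j.
Proof.
have [w wP] := @moore_surj 3 1 lambda (erefl _) lambda_inj (fun j => (y j)%:M).
by exists (w *m M) => j; rewrite /U mulmxK // /cform wP mxE eqxx mulr1n.
Qed.

Let subplane_point t : t != 0 ->
  exists2 x, <[x]>%VS \in pi & forall j, U j x = frob j t.
Proof.
move=> t0; have [u uP] := @moore_surj_base 3 1 lambda (erefl _) lambda_inj t%:M.
have ut : val_form lambda u = t by rewrite val_formE uP mxE eqxx mulr1n.
exists (map_mx (in_alg L) u *m M); last by move=> j; rewrite U_base ut.
apply/mem_subplane; exists u => //.
by apply: contraNneq t0 => u0; rewrite -ut u0 linear0.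
Qed.

Let subplane_pointE P : P \in pi ->
  exists x t, [/\ t != 0, P = <[x]>%VS & forall j, U j x = frob j t].
Proof.
move=> /mem_subplane [u u0 ->].
exists (map_mx (in_alg L) u *m M), (val_form lambda u).
by split=> //; apply: contraNneq u0 => /val_lambda_inj ->.
Qed.

Let conj_line j : {vspace 'rV[L]_3} :=
  lker (linfun (mulmxr (invmx M *m map_mx (frob j) lambda))).

Let mem_conj_line j x : (x \in conj_line j) = (U j x == 0).
Proof.
rewrite memv_ker lfunE /= mulmxA; apply/eqP/eqP => [/matrixP/(_ 0 0)|x0].
  by rewrite [RHS]mxE.
by apply/matrixP => a b; rewrite !ord1 [RHS]mxE.
Qed.

Let conj_line0 : conj_line 0 = line_infty L.
Proof. by apply/vspaceP => x; rewrite mem_conj_line mem_line_infty U0E. Qed.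

Let conj_line_inj : injective conj_line.
Proof.
move=> i j eq_ij; have [x xU] := U_surj (fun k => (k == j)%:R).
have : x \in conj_line i = (x \in conj_line j) by rewrite eq_ij.
rewrite !mem_conj_line !xU eqxx oner_eq0 => /negbT.
by case: (i =P j) => // _; rewrite eqxx.
Qed.

Let dim_conj_line j : \dim (conj_line j) = 2%N.
Proof.
have := limg_ker_dim (linfun (mulmxr (invmx M *m map_mx (frob j) lambda))
  : 'Hom('rV[L]_3, 'rV[L]_1)) fullv.
rewrite capfv -/(conj_line j) (_ : limg _ = fullv).
  by rewrite !dimvf /dim /= => /(@addIn 1 _ 2).
apply/vspaceP => y; rewrite memvf; apply/memv_imgP.
have [x xU] := U_surj (fun=> y 0 0); exists x; rewrite ?memvf // lfunE /= mulmxA.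
by apply/matrixP => a b; rewrite !ord1; apply/esym/xU.
Qed.

(* In the frame of pi an element of I is a scalar multiple of a matrix N0 over
   F, which commutes with conjugation; so it fixes the conjugates of the line at
   infinity with that line. *)
Let in_I_conj_line N j x : in_I pi N -> U j x = 0 -> U j (x *m N) = 0.
Proof.
move=> [Nunit Npi Ninf].
have [||s [N0 N0E]] := @base_homography F L 3 (M *m N *m invmx M).
- by rewrite !unitmx_mul unitmx_inv Munit Nunit.
- move=> u u0; have uP : <[map_mx (in_alg L) u *m M]>%VS \in pi.
    by apply/mem_subplane; exists u.
  have : homography N <[map_mx (in_alg L) u *m M]>%VS \in pi.
    by rewrite -Npi; apply/imfsetP; exists <[map_mx (in_alg L) u *m M]>%VS.
  rewrite homography_line => /mem_subplane [u' _ uN].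
  have /vlineP [a uNE] : map_mx (in_alg L) u *m M *m N
      \in <[map_mx (in_alg L) u' *m M]>%VS by rewrite -uN memv_line.
  by exists a, u'; rewrite !mulmxA uNE -scalemxAl mulmxK.
have UN i y : U i (y *m N) =
    s * cform lambda i (y *m invmx M *m map_mx (in_alg L) N0).
  rewrite /U -[RHS]linearZ /= scalemxAr -N0E; congr cform.
  by rewrite !mulmxA mulmxKV.
rewrite !UN; have [->|s0] := eqVneq s 0; first by rewrite mul0r.
have N0inf w : cform lambda 0 w = 0 ->
    cform lambda 0 (w *m map_mx (in_alg L) N0) = 0.
  move=> w0; have : w *m M \in line_infty L.
    by rewrite mem_line_infty -U0E /U mulmxK // w0.
  move/(memv_img (linfun (mulmxr N))); rewrite lfunE /= -/(homography N _) Ninf.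
  rewrite mem_line_infty -U0E UN mulmxK // mulf_eq0 (negPf s0) /=.
  by move/eqP.
rewrite /U; move: (x *m invmx M) => w w0.
pose w' := map_mx (frob (- j)) w.
have wE : w = map_mx (frob j) w' by rewrite map_frobNK.
have w'0 : cform lambda 0 w' = 0.
  by apply: (fmorph_inj (frob j)); rewrite rmorph0 /= -cform_frob addr0 -wE.
have -> : w *m map_mx (in_alg L) N0 =
    map_mx (frob j) (w' *m map_mx (in_alg L) N0).
  rewrite map_mxM -wE; congr mulmx.
  by apply/matrixP => a b; rewrite !mxE; apply/esym/frob_in_alg.
by rewrite -[X in cform _ X _](addr0 j) cform_frob N0inf ?rmorph0 ?mulr0.
Qed.

Let fixed_conj_line j : fixed_line pi (conj_line j).
Proof.
split=> [|N NI]; first exact: dim_conj_line.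
have [Nunit _ _] := NI.
apply: homography_stable => // x; rewrite !mem_conj_line => /eqP xU.
by rewrite in_I_conj_line.
Qed.

Hypothesis splash_S : splash_of pi S.

(** The line joining the points of pi with parameters t and t' meets u = 0 in
    (0, - d^q, d) up to a scalar, where d = t' t^(q^2) - t t'^(q^2). *)
Lemma splash_norm x : <[x]>%VS \in S ->
  U 0 x = 0 /\ U 1 x ^+ n = (- U (-1) x) ^+ n.
Proof.
move=> /splash_S [_]; rewrite -memvE mem_line_infty -U0E => /eqP x0.
case=> l [P [Q [/subplane_pointE [p [t [t0 PE pU]]]]]].
move=> /subplane_pointE [p' [t' [t'0 QE p'U]]] _ ->.
rewrite -memvE PE QE => /memv_addP [_ /vlineP [a ->] [_ /vlineP [b ->] xE]].
split=> //.
have xU j : U j x = a * frob j t + b * frob j t'.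
  by rewrite xE linearD !linearZ /= pU p'U.
have at_ : a * t = - (b * t').
  by apply/eqP; rewrite -addr_eq0 -x0 xU !frob0.
pose d := frob (-1) t * t' - t * frob (-1) t'.
apply: (mulfI (expf_neq0 n t0)); rewrite -!exprMn.
have tU j : t * U j x = b * (t * frob j t' - t' * frob j t).
  rewrite xU (_ : t * _ = a * t * frob j t + b * (t * frob j t')); last ring.
  by rewrite at_; ring.
have -> : t * U 1 x = b * frob 1 d.
  rewrite tU /d rmorphB !rmorphM /= -!frobD subrr !frob0; ring.
have -> : t * - U (-1) x = b * d by rewrite mulrN tU /d; ring.
by rewrite !exprMn frob_expr.
Qed.

(** Hilbert 90 gives b such that the line
    b u + b^q u^sigma + b^(q^2) u^(sigma^2) = 0, which is a line of pi, passes
    through x. *)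
Lemma norm_splash x : x != 0 -> U 0 x = 0 -> U 1 x ^+ n = (- U (-1) x) ^+ n ->
  <[x]>%VS \in S.
Proof.
move=> x_neq0 x0 x12.
have x2 : U (-1) x != 0.
  apply: contraNneq x_neq0 => x2; apply/eqP/U_inj0 => j.
  have x1 : U 1 x = 0.
    apply/eqP; move/eqP: x12; rewrite x2 oppr0 expr0n addn1 /=.
    by rewrite expf_eq0.
  by case: (ord3P j) => ->.
have [z z0 zE] : exists2 z, z != 0 & frob 1 z = - U 1 x / U (-1) x * z.
  apply: hilbert90; rewrite expr_div_n -(mulN1r (U 1 x)) exprMn x12 -exprMn.
  by rewrite mulN1r opprK divff // expf_neq0.
pose b := frob (-1) z; have b0 : b != 0 by rewrite fmorph_eq0.
have fb : frob 1 b = z by rewrite -frobD subrr frob0.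
(* A point of pi is on that line when its parameter t makes the trace of b t
   zero.  Any x^q - x can be b t; here x is tau, then tau^2, and s comes from
   (tau^2)^q - tau^2 = (tau^q - tau) (tau^q + tau). *)
pose s := frob 1 tau + tau.
pose t := (frob 1 tau - tau) / b; pose t' := t * s.
have tau01 : frob 1 tau - tau != 0.
  by rewrite subr_eq0 -{2}[tau]frob0 frob_tau_eq.
have tau02 : frob (-1) tau - tau != 0.
  by rewrite subr_eq0 -{2}[tau]frob0 frob_tau_eq.
have tau12 : frob (-1) tau - frob 1 tau != 0 by rewrite subr_eq0 frob_tau_eq.
have t0 : t != 0 by rewrite mulf_neq0 ?invr_eq0.
have s1 : frob 1 s = frob (-1) tau + frob 1 tau.
  by rewrite rmorphD /= -frobD ord3_11.
have s2 : frob (-1) s = tau + frob (-1) tau.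
  by rewrite rmorphD /= -frobD addNr frob0.
have s0 : s != 0.
  apply: contraNneq tau02 => s0.
  have <- : frob 1 s - s = frob (-1) tau - tau by rewrite s1 /s; ring.
  by rewrite s0 rmorph0 subrr.
have [p pP pU] := subplane_point t0.
have [p' p'P p'U] := subplane_point (mulf_neq0 t0 s0 : t' != 0).
apply/splash_S; split.
- by rewrite dim_vline x_neq0.
- by rewrite -memvE mem_line_infty -U0E x0.
exists (<[p]> + <[p']>)%VS.
  exists <[p]>%VS, <[p']>%VS; split=> //.
  apply/eqP => pp'; have p0 : p != 0.
    by apply: contraNneq t0 => p0; rewrite -(frob0 t) -pU p0 linear0.
  have [a _ pa] := line_eq p0 pp'.
  have aE j : 1 = a * frob j s.
    apply: (@mulfI _ (frob j t)); first by rewrite fmorph_eq0.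
    by rewrite mulr1 mulrCA -rmorphM /= -/t' -pU -p'U {1}pa linearZ.
  have a0 : a != 0.
    by apply: contraTneq isT => a0; have /eqP := aE 0; rewrite a0 mul0r oner_eq0.
  have /(mulfI a0) : a * frob 1 s = a * frob 0 s by rewrite -!aE.
  rewrite frob0 s1 /s [RHS]addrC => /addIr/eqP.
  by rewrite -subr_eq0 (negPf tau02).
pose d := t * frob (-1) t' - t' * frob (-1) t.
have dE : d = t * frob (-1) t * (frob (-1) tau - frob 1 tau).
  rewrite /d /t' rmorphM /= s2 /s; ring.
have d0 : d != 0.
  by rewrite dE; do 2?[apply: mulf_neq0 => //]; rewrite fmorph_eq0.
have bt j : frob j b * frob j t = frob (j + 1) tau - frob j tau.
  by rewrite -rmorphM /t mulrC divfK // rmorphB /= -frobD.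
have x1d : U 1 x * d = U (-1) x * (t * frob 1 t' - t' * frob 1 t).
  have e1 := bt 1; rewrite fb ord3_11 in e1.
  have e2 := bt (-1); rewrite addNr frob0 in e2.
  have fb2 : frob (-1) b = - U 1 x / U (-1) x * z by rewrite -ord3_11 frobD fb zE.
  have {}e2 : U 1 x * z * frob (-1) t = U (-1) x * (frob (-1) tau - tau).
    by rewrite -opprB -e2 fb2; field.
  have ft' : frob 1 t' = frob 1 t * frob 1 s by rewrite -rmorphM.
  apply: (mulfI z0); rewrite dE ft' s1 /t' /s.
  rewrite (_ : z * (U 1 x * _) =
    U 1 x * z * frob (-1) t * t * (frob (-1) tau - frob 1 tau)); last ring.
  rewrite e2 -e1; ring.
have xE : x = U (-1) x / d *: (t *: p' - t' *: p).
  apply/eqP; rewrite -subr_eq0; apply/eqP/U_inj0 => j.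
  rewrite linearB linearZ /= linearB !linearZ /= pU p'U.
  case: (ord3P j) => ->.
  - by rewrite x0 !frob0; ring.
  - by apply: (mulIf d0); rewrite mul0r mulrBl x1d; field.
  by rewrite -/d divfK // subrr.
rewrite -memvE xE memvZ // memvB ?memvZ //.
  by rewrite (subvP (addvSr _ _)) ?memv_line.
by rewrite (subvP (addvSl _ _)) ?memv_line.
Qed.

Hypothesis carriers_E : carriers_of pi E1 E2.

(* The carriers come without an order: E1 is on the first or on the second
   conjugate of the line at infinity. *)
Let carriers_conj : exists2 i : 'I_3, i != 0 &
  E1 = (line_infty L :&: conj_line i)%VS /\
  E2 = (line_infty L :&: conj_line (- i))%VS.
Proof.
have [m1 [m2 [uniq_lines fixedP E1E E2E]]] := carriers_E.
have on_list i : i != 0 -> conj_line i = m1 \/ conj_line i = m2.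
  move=> i0; have /fixedP := fixed_conj_line i; rewrite !inE => /or3P [] /eqP.
  - by rewrite -conj_line0 => /conj_line_inj /eqP; rewrite (negPf i0).
  - by left.
  by right.
have neq : conj_line 1 != conj_line (-1).
  by apply/eqP => /conj_line_inj/(congr1 val).
case: (on_list 1 isT) => e1; case: (on_list (-1) isT) => e2.
- by case/eqP: neq; rewrite e1 e2.
- by exists 1; rewrite // e1 e2.
- by exists (-1); rewrite // opprK e1 e2.
by case/eqP: neq; rewrite e1 e2.
Qed.

Let splash_normE x : x != 0 -> U 0 x = 0 ->
  <[x]>%VS \in S <-> U 1 x ^+ n = (- U (-1) x) ^+ n.
Proof. by move=> xneq0 x0; split=> [/splash_norm []|/norm_splash] //; apply. Qed.

Lemma subplane_splash_coordinates :
  exists a1 a2 : 'cV[L]_3, splash_coordinates S E1 E2 a1 a2.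
Proof.
pose f i : 'cV[L]_3 := invmx M *m map_mx (frob i) lambda.
have fU i x : (x *m f i) 0 0 = U i x by rewrite /f mulmxA.
have [i i0 [E1E E2E]] := carriers_conj.
have UN : forall x, U i x = 0 -> U (- i) x = 0 -> U 1 x = 0 /\ U (-1) x = 0.
  by move=> x; case: (ord3P i) i0 => -> //; rewrite ?opprK.
exists (- f (- i)), (f i); split.
- move=> x; rewrite mem_line_infty -U0E => /eqP x0.
  rewrite mulmxN mxE !fU => /eqP; rewrite oppr_eq0 => /eqP xNi xi.
  have [x1 x2] := UN x xi xNi.
  by apply: U_inj0 => j; case: (ord3P j) => ->.
- move=> y z; have [x xU] := U_surj (fun j => if j == 0 then 0
    else if j == i then z else - y).
  exists x; first by rewrite mem_line_infty -U0E xU eqxx.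
  rewrite mulmxN mxE !fU !xU (negPf i0) eqxx oppr_eq0 (negPf i0).
  by case: (ord3P i) i0 => -> //=; rewrite opprK.
- by move=> x; rewrite E1E memv_cap mem_conj_line fU.
- by move=> x; rewrite E2E memv_cap mem_conj_line mulmxN mxE fU oppr_eq0.
split=> [P /splash_S [dimP Pinf _]|x x0].
  have [P0 PE] := dim1_line dimP.
  by exists (vpick P); split=> //; rewrite memvE -PE.
rewrite mem_line_infty -U0E => /eqP xinf.
rewrite mulmxN mxE !fU; have [normS Snorm] := splash_normE x0 xinf.
have normN (a b : L) : a ^+ n = (- b) ^+ n -> (- a) ^+ n = b ^+ n.
  by move=> ab; rewrite -(mulN1r a) exprMn ab -exprMn mulN1r opprK.
case: (ord3P i) i0 => -> // _; rewrite ?opprK.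
  by split=> [/normS ->|/esym/Snorm].
split=> [/normS/normN //|xN]; apply: Snorm.
by have := normN (- U 1 x) (- U (-1) x); rewrite !opprK; apply.
Qed.

End Splash.

Lemma exterior_splash_coordinates S E1 E2 : exterior_splash S E1 E2 ->
  exists a1 a2 : 'cV[L]_3, splash_coordinates S E1 E2 a1 a2.
Proof.
case=> pi [[M Munit piP] ext splash_S carriers_E].
exact: (subplane_splash_coordinates Munit piP).
Qed.

(** Forms on a projective line with the same zero are proportional. *)
Lemma splash_coordinates_change S S' E1 E2 (a1 a2 b1 b2 : 'cV[L]_3) :
    splash_coordinates S E1 E2 a1 a2 -> splash_coordinates S' E1 E2 b1 b2 ->
  exists2 k, k != 0 & forall x, x != 0 -> x \in line_infty L ->
    <[x]>%VS \in S' <-> (x *m a1) 0 0 ^+ n = (k * (x *m a2) 0 0) ^+ n.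
Proof.
move=> [a_inj a_surj E1a E2a _] [b_inj _ E1b E2b [_ S'b]].
have dotD (a : 'cV[L]_3) s t x y :
    ((s *: x + t *: y) *m a) 0 0 = s * (x *m a) 0 0 + t * (y *m a) 0 0.
  by rewrite mulmxDl -!scalemxAl !mxE.
have [x1 x1inf [x1a1 x1a2]] := a_surj 1 0.
have [x2 x2inf [x2a1 x2a2]] := a_surj 0 1.
have x1b2 : (x1 *m b2) 0 0 = 0.
  by have := E1a x1; rewrite E1b x1inf x1a2 eqxx => /eqP.
have x2b1 : (x2 *m b1) 0 0 = 0.
  by have := E2a x2; rewrite E2b x2inf x2a1 eqxx => /eqP.
have x1b1 : (x1 *m b1) 0 0 != 0.
  apply: contraTneq isT => x1b1; have /eqP := x1a1.
  by rewrite (b_inj x1) // mul0mx mxE eq_sym oner_eq0.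
have x2b2 : (x2 *m b2) 0 0 != 0.
  apply: contraTneq isT => x2b2; have /eqP := x2a2.
  by rewrite (b_inj x2) // mul0mx mxE eq_sym oner_eq0.
exists ((x2 *m b2) 0 0 / (x1 *m b1) 0 0) => [|x x0 xinf].
  by rewrite mulf_neq0 ?invr_eq0.
set y := (x *m a1) 0 0; set z := (x *m a2) 0 0.
have xE : x = y *: x1 + z *: x2.
  apply/eqP; rewrite -subr_eq0; apply/eqP/a_inj.
  - by rewrite rpredB ?rpredD ?memvZ.
  - by rewrite mulmxBl mxE [X in _ + X]mxE dotD x1a1 x2a1 mulr1 mulr0 addr0 subrr.
  by rewrite mulmxBl mxE [X in _ + X]mxE dotD x1a2 x2a2 mulr1 mulr0 add0r subrr.
rewrite (S'b x x0 xinf) {1 2}xE !dotD x1b2 x2b1 !mulr0 addr0 add0r.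
rewrite !exprMn exprVn; split=> E.
  by rewrite mulrAC [_ * z ^+ n]mulrC -E mulfK // expf_neq0.
by rewrite E mulrAC divfK ?expf_neq0 // mulrC.
Qed.

(** * The Bruck-Bose correspondence *)

Let powers : 'cV[L]_3 := \col_i tau ^+ i.
Let powers_tuple := [tuple tau ^+ k | k < 3].

Let val_powers (s : 'rV[F]_3) : val_form powers s = \sum_i s 0 i *: powers_tuple`_i.
Proof.
rewrite val_formE mxE; apply: eq_bigr => i _; rewrite !mxE.
by rewrite mulr_algl -tnth_nth tnth_mktuple.
Qed.

(* A relation would be a polynomial of degree at most 2 over F with the three
   conjugates of tau as roots. *)
Let free_powers : free powers_tuple.
Proof.
apply/freeP => c sum0 i.
pose p : {poly L} := \poly_(k < 3) in_alg L (c (inord k)).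
suff p0 : p = 0.
  have := coef_poly 3 (fun k => in_alg L (c (inord k))) i.
  rewrite -/p p0 coef0 ltn_ord inord_val => /esym/eqP.
  by rewrite fmorph_eq0 => /eqP.
have root_p : p.[tau] = 0.
  rewrite horner_poly -[RHS]sum0; apply: eq_bigr => k _.
  by rewrite inord_val mulr_algl -tnth_nth tnth_mktuple.
apply: (@roots_geq_poly_eq0 _ p [seq frob j tau | j <- enum 'I_3]).
- apply/allP => _ /mapP [j _ ->]; rewrite rootE.
  suff -> : p.[frob j tau] = frob j p.[tau] by rewrite root_p rmorph0.
  rewrite !horner_poly rmorph_sum; apply: eq_bigr => k _.
  by rewrite rmorphM rmorphXn /= frob_in_alg.
- rewrite map_inj_uniq ?enum_uniq // => i1 i2 /eqP.
  by rewrite frob_tau_eq => /eqP.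
by rewrite size_map -cardE card_ord size_poly.
Qed.

Let coordinatesK (x : L) : val_form powers (coordinates tau x) = x.
Proof.
rewrite val_powers; have xin : x \in <<powers_tuple>>%VS.
  suff -> : <<powers_tuple>>%VS = fullv by rewrite memvf.
  by apply/eqP; rewrite eqEdim subvf dimL (eqP free_powers) size_tuple.
by rewrite [RHS](coord_span xin); apply: eq_bigr => i _; rewrite mxE.
Qed.

Let val_powersK (s : 'rV[F]_3) : coordinates tau (val_form powers s) = s.
Proof. by apply/rowP => i; rewrite mxE val_powers coord_sum_free ?free_powers. Qed.

Lemma mem_bb_plane a b (v : 'rV[F]_(3 + 3)) : v \in bb_plane tau a b <->
  exists x, val_form powers (lsubmx v) = a * x /\
    val_form powers (rsubmx v) = b * x.
Proof.
pose f (x : L) : 'rV[F]_6 :=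
  row_mx (coordinates tau (a * x)) (coordinates tau (b * x)).
have coordP s x y :
    coordinates tau (s *: x + y) = s *: coordinates tau x + coordinates tau y.
  by apply/rowP => i; rewrite !mxE linearP.
have f_linear : linear f.
  move=> s x y; rewrite /f !mulrDr -!scalerAr !coordP.
  by apply/esym; rewrite (@scale_row_mx _ 1 3 3) (@add_row_mx _ 1 3 3).
pose fL : {linear L -> 'rV[F]_6} :=
  HB.pack f (GRing.isLinear.Build _ _ _ _ f f_linear).
rewrite /bb_plane -/f -[linfun f]/(linfun fL).
split=> [/memv_imgP [x _ vE]|[x [vl vr]]].
  exists x; move: vE; rewrite lfunE /= /f => ->.
  by rewrite row_mxKl row_mxKr !coordinatesK.
apply/memv_imgP; exists x; rewrite ?memvf // lfunE /= /f -vl -vr !val_powersK.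
by rewrite hsubmxK.
Qed.

(* F^6 is identified with L^2, and L^2 with the vectors of the line at
   infinity. *)
Let bb_vector (v : 'rV[F]_(3 + 3)) : 'rV[L]_3 :=
  val_form powers (lsubmx v) *: delta_mx 0 0
  + val_form powers (rsubmx v) *: delta_mx 0 1.

Let bb_vectorE v : [/\ bb_vector v 0 0 = val_form powers (lsubmx v),
  bb_vector v 0 1 = val_form powers (rsubmx v) & bb_vector v \in line_infty L].
Proof.
rewrite mem_line_infty /bb_vector !mxE /=.
by rewrite !(mulr1, mulr0, addr0, add0r).
Qed.

(* The plane [P] is the line P of L^2 seen as a subspace over F. *)
Let mem_bb_point x v : x != 0 -> x \in line_infty L ->
  (v \in bb_point tau <[x]>%VS) = (bb_vector v \in <[x]>%VS).
Proof.
move=> x0 xinf; have [p0 pE] := dim1_line (etrans (dim_vline x) (congr1 _ x0)).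
rewrite [in RHS]pE /bb_point; set p := vpick _ in p0 pE *.
have pinf : p 0 ord_max = 0.
  by apply/eqP; rewrite -mem_line_infty memvE -pE -memvE.
have [v0 v1 vinf] := bb_vectorE v.
apply/idP/vlineP => [/mem_bb_plane [y [vl vr]]|[y vE]].
  exists y; apply/rowP => i; rewrite [RHS]mxE mulrC.
  move: vinf; rewrite mem_line_infty => /eqP vinf.
  case: (ord3P i) => ->.
  - by rewrite v0.
  - by rewrite v1.
  have -> : -1 = ord_max :> 'I_3 by exact: val_inj.
  by rewrite pinf mul0r.
apply/mem_bb_plane; exists y; rewrite -v0 -v1 vE !mxE.
by split; rewrite mulrC.
Qed.

(** The form a on the line at infinity, read on F^6. *)
Definition bb_form (a : 'cV[L]_3) : 'cV[L]_(3 + 3) :=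
  col_mx (a 0 0 *: powers) (a 1 0 *: powers).

Let val_bb_form a (v : 'rV[F]_(3 + 3)) :
  val_form (bb_form a) v = (bb_vector v *m a) 0 0.
Proof.
rewrite /bb_vector mulmxDl -!scalemxAl -!rowE !mxE.
rewrite val_formE -[in LHS](hsubmxK v) map_row_mx mul_row_col mxE !val_formE.
by rewrite -!scalemxAr [LHS]addrC addrC !mxE ![_ * a _ _]mulrC.
Qed.

Section BBForms.
Variables (S : {fset {vspace 'rV[L]_3}}) (E1 E2 : {vspace 'rV[L]_3}).
Variables a1 a2 : 'cV[L]_3.
Hypothesis a12 : splash_coordinates S E1 E2 a1 a2.
Let eta := bb_form a1.
Let zeta := bb_form a2.

Lemma bb_form_inj v : val_form eta v = 0 -> val_form zeta v = 0 -> v = 0.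
Proof.
rewrite !val_bb_form => v1 v2; have [a_inj _ _ _ _] := a12.
have [v0' v1' vinf] := bb_vectorE v.
have v0 := a_inj _ vinf v1 v2; rewrite v0 !mxE in v0' v1'.
rewrite -[v](@hsubmxK _ 1 3 3) -[lsubmx v]val_powersK -[rsubmx v]val_powersK.
rewrite -v0' -v1'.
have -> : coordinates tau 0 = 0 by apply/rowP => i; rewrite !mxE linear0.
exact: row_mx0.
Qed.

(** A point of the splash with y / z = k corresponds to the plane y = k z. *)
Lemma bb_planes_norm_class r S' k0 :
    n.-primitive_root r -> k0 != 0 ->
    (forall P, P \in S' ->
      exists x, [/\ x != 0, x \in line_infty L & P = <[x]>%VS]) ->
    (forall x, x != 0 -> x \in line_infty L ->
      <[x]>%VS \in S' <-> (x *m a1) 0 0 ^+ n = (k0 * (x *m a2) 0 0) ^+ n) ->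
  bb_planes tau S' = norm_class eta zeta r k0 0.
Proof.
have dotZ (a : 'cV[L]_3) s x : ((s *: x) *m a) 0 0 = s * (x *m a) 0 0.
  by rewrite -scalemxAl mxE.
have dotB (a : 'cV[L]_3) (x y : 'rV[L]_3) :
    ((x - y) *m a) 0 0 = (x *m a) 0 0 - (y *m a) 0 0.
  by rewrite mulmxBl mxE [X in _ + X]mxE.
move=> prim_r k0_neq0 S'line S'P; have [a_inj a_surj _ _ _] := a12.
have point_plane x k : x != 0 -> x \in line_infty L -> (x *m a2) 0 0 != 0 ->
    (x *m a1) 0 0 = k * (x *m a2) 0 0 ->
    bb_point tau <[x]>%VS = plane eta zeta 0 k.
  move=> x0 xinf xa2 xk; apply/vspaceP => v; rewrite mem_bb_point //.
  have [_ _ vinf] := bb_vectorE v.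
  apply/vlineP/mem_plane; rewrite frob0 !val_bb_form.
    by case=> s ->; rewrite !dotZ xk mulrCA.
  move=> vk.
  exists ((bb_vector v *m a2) 0 0 / (x *m a2) 0 0).
  apply/eqP; rewrite -subr_eq0; apply/eqP/a_inj.
  - by rewrite rpredB ?memvZ.
  - by rewrite dotB dotZ vk xk; field.
  by rewrite dotB dotZ; field.
apply/fsetP => W; apply/imfsetP/idP.
  move=> [P /= PS' ->]; have [x [x0 xinf PE]] := S'line P PS'.
  move: PS'; rewrite PE => /(S'P x x0 xinf) xn.
  have xa2 : (x *m a2) 0 0 != 0.
    apply: contraNneq x0 => xa2; apply/eqP/a_inj => //.
    by apply/eqP; move/eqP: xn; rewrite xa2 mulr0 expr0n addn1 expf_eq0.
  apply/(mem_norm_class _ _ prim_r k0_neq0).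
  exists ((x *m a1) 0 0 / (x *m a2) 0 0).
    by rewrite expr_div_n xn exprMn mulfK // expf_neq0.
  by apply: point_plane; rewrite // divfK.
move/(mem_norm_class _ _ prim_r k0_neq0) => [k kn ->].
have [x xinf [xa1 xa2]] := a_surj k 1.
have x0 : x != 0.
  apply: contraTneq isT => x0; move/eqP: xa2.
  by rewrite x0 mul0mx mxE eq_sym oner_eq0.
exists <[x]>%VS; first by apply/(S'P x x0 xinf); rewrite xa1 xa2 mulr1.
by apply/esym/point_plane; rewrite // ?xa2 ?oner_eq0 // xa1 mulr1.
Qed.

End BBForms.

End CubicExtension.

Theorem theorem6p6 (F : finFieldType) (L : fieldExtType F) (tau : L)
    (E1 E2 : {vspace 'rV[L]_3})
    (S : 'I_(#|F| - 1) -> {fset {vspace 'rV[L]_3}})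
    (dimL : \dim {:L} = 3%N)
    (tau_prim : primitive_element tau)
    (splashS : forall j, exterior_splash (S j) E1 E2)
    (disjS : forall i j, i != j -> [disjoint S i & S j]%fset) :
  exists C T : 'I_(#|F| - 1) -> {fset {vspace 'rV[F]_6}},
    (forall j, covers_of (bb_planes tau (S j)) (C j) (T j)) /\
    exists gC gT : {vspace 'rV[L]_6},
      (forall j, transversals_of (C j) gC) /\
      (forall j, transversals_of (T j) gT).
Proof.
(* One splash fixes the coordinates y and z, in which all are then written. *)
have j0 : 'I_(#|F| - 1) by apply: (@Ordinal _ 0); rewrite subn_gt0 q_gt1.
have [a1 [a2 a12]] := exterior_splash_coordinates dimL tau_prim (splashS j0).
have [r prim_r] := n_prim_root dimL.
have S_k j : exists k, k != 0 /\ bb_planes tau (S j) =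
    norm_class (bb_form tau a1) (bb_form tau a2) r k 0.
  have [b1 [b2 b12]] := exterior_splash_coordinates dimL tau_prim (splashS j).
  have [k k0 kP] := splash_coordinates_change a12 b12; exists k; split=> //.
  have [_ _ _ _ [Sline _]] := b12.
  exact: (bb_planes_norm_class dimL tau_prim a12 prim_r k0 Sline kP).
have [k kP] := fin_all_exists S_k.
have inj12 := bb_form_inj dimL tau_prim a12.
exists (fun j => norm_class (bb_form tau a1) (bb_form tau a2) r (k j) 1).
exists (fun j => norm_class (bb_form tau a1) (bb_form tau a2) r (k j) (-1)).
split=> [j|].
  have [k0 ->] := kP j; exact: (covers_norm_class dimL tau_prim inj12 prim_r k0).
have [gC gCP] := coordinate_line_ex dimL tau_prim inj12 1 0.
have [gT gTP] := coordinate_line_ex dimL tau_prim inj12 (-1) 0.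
exists gC, gT; split=> j; have [k0 _] := kP j.
  exact: (transversals_norm_class dimL tau_prim inj12 prim_r k0 gCP).
exact: (transversals_norm_class dimL tau_prim inj12 prim_r k0 gTP).
Qed.
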